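(* Let $c = 1+\sqrt{928/33}$. There exist a function $h:\mathbb{N}\to\mathbb{R}$ with $h(t)=o(t^2)$ as $t\to\infty$ and an integer $t_0$ such that for every integer $t\ge t_0$ and every finite set $X$ with $|X|=n\ge ct^2+h(t)$, every $t$-extremal $3$-uniform hypergraph $\mathcal{F}$ on $X$ contains an isolated copy of $K^3_{t+1}$.
   Context: Let $X$ be a finite set and $\mathcal{F}\subseteq\binom{X}{3}$ a family of $3$-element subsets of $X$, regarded as a $3$-uniform hypergraph with vertex set $X$. The degree of $u\in X$ is the number of members of $\mathcal{F}$ containing $u$, and $\delta(\mathcal{F})$ is the minimum degree over all $u\in X$. The $2$-shadow $\partial_2\mathcal{F}$ is the family of all $2$-element subsets of $X$ contained in at least one member of $\mathcal{F}$. For an integer $t\ge2$, $\mathcal{F}$ is $t$-extremal on $X$ if $\delta(\mathcal{F})\ge\binom{t}{2}$ and $|\partial_2\mathcal{F}|$ is minimum among all families $\mathcal{F}'\subseteq\binom{X}{3}$ with $\delta(\mathcal{F}')\ge\binom{t}{2}$. $K^3_{t+1}$ is the complete $3$-uniform hypergraph on $t+1$ vertices. An isolated copy of $K^3_{t+1}$ in $\mathcal{F}$ is a set $S\subseteq X$ with $|S|=t+1$ such that $\binom{S}{3}\subseteq\mathcal{F}$ and no member of $\mathcal{F}$ meets both $S$ and $X\setminus S$. *)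

(* Defs.v *)
From mathcomp Require Import all_boot all_order all_algebra.

Set Implicit Arguments.
Unset Strict Implicit.
Unset Printing Implicit Defensive.

(* Hypergraphs on the finite vertex set [set: X] are families of type
   {set {set X}}; a finite set is represented by an arbitrary finType X. *)

Definition uniform3 (X : finType) (F : {set {set X}}) : Prop :=
  forall e : {set X}, e \in F -> #|e| = 3.

Definition degree (X : finType) (F : {set {set X}}) (u : X) : nat :=
  #|[set e in F | u \in e]|.

(* Every degree is at most #|F|, so taking #|F| as the neutral element does not
   change the minimum when X is nonempty; it only fixes the value for empty X. *)
Definition min_degree (X : finType) (F : {set {set X}}) : nat :=
  \big[minn/#|F|]_(u : X) degree F u.

Definition shadow2 (X : finType) (F : {set {set X}}) : {set {set X}} :=
  [set p : {set X} | (#|p| == 2) && [exists e in F, p \subset e]].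

Definition extremal (t : nat) (X : finType) (F : {set {set X}}) : Prop :=
  [/\ uniform3 F,
      'C(t, 2) <= min_degree F
    & forall F' : {set {set X}},
        uniform3 F' -> 'C(t, 2) <= min_degree F' ->
        #|shadow2 F| <= #|shadow2 F'| ].

Definition isolated_K3 (t : nat) (X : finType) (F : {set {set X}})
    (S : {set X}) : Prop :=
  [/\ #|S| = t.+1,
      forall e : {set X}, e \subset S -> #|e| = 3 -> e \in F
    & forall e : {set X}, e \in F ->
        ~ (e :&: S != set0 /\ e :&: ~: S != set0) ].

(* Main.v *)
(** Pass to the shadow graph [g]: it minimises the number of edges among graphs
    in which every vertex lies in at least [C(t, 2)] triangles.  Every degree is
    at least [t]; call [deg v - t] the excess of [v].  A vertex of excess 0 spans
    with its neighbours a [(t+1)]-clique.  Covering the vertices by cliques, two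
    of which overlap, shows that the total excess is at most [(t+1)^2 / 4].

    Assume that no component is a [(t+1)]-clique.  Vertices of positive excess,
    and vertices of excess 0 whose clique [K] sends more than [t/16] edges
    outside, are at most [18] times the total excess in number.  Call the other
    cliques good; for [z] outside such a [K], let [d z] be the number of
    neighbours of [z] in [K].  One may detach [K] and reattach its neighbours to
    initial segments of a fixed enumeration of [K], possibly merging two good
    cliques into one, without loss of triangles.  Minimality then yields, for
    each good [K], a vertex [z_K] with [d] almost maximal, all of whose
    neighbours have positive excess, and which has fewer than [t/8] common
    neighbours outside [K] with any non-neighbour; and for different good
    cliques these vertices are distinct and non-adjacent.  So the neighbourhoods
    of the [z_K] are almost disjoint sets of about [t] vertices of positive
    excess, and the number of good cliques is at most [6/t] times the total
    excess.  Altogether the number of vertices is at most about [6 t^2]. *)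
Require Import Defs.
From mathcomp Require Import all_boot all_order all_algebra.
From mathcomp Require Import zify.

Set Implicit Arguments.
Unset Strict Implicit.
Unset Printing Implicit Defensive.

(** * Graphs and triangle weights *)

Section Graph.
Variable X : finType.
Implicit Types (g h : rel X) (A B C S : {set X}).

Definition graph g := symmetric g /\ irreflexive g.
Definition nb g v := [set u | g v u].
(* Pairs are ordered: [wt] and [vol] below are twice the numbers of triangles at a
   vertex and of edges. *)
Definition tri g v := [set p : X * X | [&& g v p.1, g v p.2 & g p.1 p.2]].
Definition wt g v := #|tri g v|.
Definition vol g := \sum_v #|nb g v|.
Definition cliq g S := {in S &, forall u v, u != v -> g u v}.

Lemma graph_sym g : graph g -> symmetric g. Proof. by case. Qed.
Lemma graph_irr g : graph g -> irreflexive g. Proof. by case. Qed.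

Lemma wtE g v : wt g v = \sum_(u in nb g v) #|nb g v :&: nb g u|.
Proof.
rewrite (eq_bigr (fun u => \sum_(w in nb g v :&: nb g u) 1)); last first.
  by move=> u _; rewrite sum1_card.
rewrite pair_big_dep /= sum1_card; apply: eq_card => -[u w].
by rewrite !inE unfold_in /= !inE.
Qed.

Lemma sub_nb g h v : subrel g h -> nb g v \subset nb h v.
Proof. by move=> gh; apply/subsetP=> u; rewrite !inE; apply: gh. Qed.

Lemma wt_sub g h v : subrel g h -> wt g v <= wt h v.
Proof.
move=> gh; apply/subset_leq_card/subsetP => -[u w]; rewrite !inE /=.
by case/and3P=> /gh-> /gh-> /gh->.
Qed.

(** Each [c] in [C] completes with [v] and [y] a triangle of [h] that was not one of [g]; it
    contributes the two ordered pairs [(y, c)] and [(c, y)]. *)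
Lemma wt_gain g h v y C : graph g -> graph h -> subrel g h -> h v y ->
  C \subset nb h v :&: nb h y ->
  {in C, forall c, ~~ [&& g v y, g v c & g y c]} ->
  wt g v + 2 * #|C| <= wt h v.
Proof.
move=> [gs gi] [hs hi] gh hvy /subsetP CS Cn.
pose T1 := [set (y, c) | c in C]; pose T2 := [set (c, y) | c in C].
have c1 : #|T1| = #|C| by rewrite card_imset // => a b [].
have c2 : #|T2| = #|C| by rewrite card_imset // => a b [].
have yC : y \notin C by apply/negP => /CS; rewrite !inE hi andbF.
have d12 : T1 :&: T2 = set0.
  apply/setP=> p; rewrite !inE; apply/negP => /andP[/imsetP[c cC ->] /imsetP[c' c'C [e _]]].
  by rewrite e c'C in yC.
have dg : tri g v :&: (T1 :|: T2) = set0.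
  apply/setP=> p; rewrite !inE; apply/negP => /andP[/and3P[a b c]] /orP[] /imsetP[d dC e];
    move: (Cn _ dC); rewrite e /= in a b c.
    by rewrite a b c.
  by rewrite a b gs c.
have <- : #|tri g v :|: (T1 :|: T2)| = wt g v + 2 * #|C|.
  by rewrite !cardsU dg d12 cards0 c1 c2 /wt; lia.
apply/subset_leq_card/subsetP => p; rewrite !inE => /orP[/and3P[a b c]|/orP[]/imsetP[c /CS]].
- by rewrite (gh _ _ a) (gh _ _ b) (gh _ _ c).
- by rewrite !inE => /andP[a b] -> /=; rewrite hvy a b.
- by rewrite !inE => /andP[a b] -> /=; rewrite hvy a hs b.
Qed.

Lemma cliq_wt g S v : cliq g S -> v \in S ->
  #|S|.-1 * #|S|.-2 <= wt g v.
Proof.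
move=> cS vS.
have eS : #|S :\ v| = #|S|.-1 by rewrite (cardsD1 v S) vS.
have sub : S :\ v \subset nb g v.
  by apply/subsetP=> u; rewrite !inE => /andP[uv uS]; apply: cS; rewrite // eq_sym.
rewrite wtE (big_setID (S :\ v)) /=; apply: leq_trans (leq_addr _ _).
rewrite (setIidPr sub) -eS -sum_nat_const; apply: leq_sum => u uS.
have <- : #|S :\ v :\ u| = #|S :\ v|.-1 by rewrite (cardsD1 u (S :\ v)) uS.
apply/subset_leq_card/subsetP => w; rewrite !inE => /and3P[wu wv wS].
by move: uS; rewrite !inE => /andP[_ uS]; rewrite !cS // eq_sym.
Qed.

Lemma wt_le g v : graph g -> wt g v <= #|nb g v| * #|nb g v|.-1.
Proof.
move=> [gs gi]; rewrite wtE -sum_nat_const; apply: leq_sum => u; rewrite inE => gu.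
rewrite (cardsD1 u (nb g v)) !inE gu /=; apply/subset_leq_card/subsetP => w.
rewrite !inE => /andP[-> gw]; rewrite andbT; apply: contraTneq gw => ->.
by rewrite gi.
Qed.

(** A missing edge between two neighbours of [v] makes a summand of [wtE] smaller than the degree
    minus 1, so equality in [wt_le] excludes it. *)
Lemma wt_full g v : graph g -> wt g v = #|nb g v| * #|nb g v|.-1 ->
  cliq g (v |: nb g v).
Proof.
move=> gg; have [gs gi] := gg => e.
have key u w : g v u -> g v w -> u != w -> g u w.
  move=> gu gw uw; apply: contraTT (eqxx (wt g v)) => nuw.
  rewrite {2}e neq_ltn; apply/orP; left.
  rewrite wtE -sum_nat_const (bigD1 u) ?inE //= [X in _ < X](bigD1 u) ?inE //=.
  rewrite -addSn; apply: leq_add.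
    have -> : #|nb g v| = #|nb g v :\ u :\ w|.+2.
      by rewrite (cardsD1 u (nb g v)) (cardsD1 w (_ :\ _)) !inE gu gw eq_sym uw.
    rewrite ltnS; apply/subset_leq_card/subsetP => x; rewrite !inE => /andP[-> gx].
    rewrite andbT; apply/andP; split; apply: contraTneq gx => -> //.
    by rewrite gi.
  apply: leq_sum => x; rewrite inE => /andP[gx _].
  rewrite (cardsD1 x (nb g v)) !inE gx /=; apply/subset_leq_card/subsetP => y.
  rewrite !inE => /andP[-> gy]; rewrite andbT; apply: contraTneq gy => ->.
  by rewrite gi.
move=> u w; rewrite !inE => /orP[/eqP->|gu] /orP[/eqP->|gw]; rewrite ?eqxx // => uw.
  by rewrite gs.
exact: key.
Qed.

End Graph.

(** * Adding edges *)

Section Add.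
Variable X : finType.
Implicit Types (g h : rel X) (A B C S : {set X}) (f : X -> X).

Definition addf h B f : rel X :=
  fun u v => [|| h u v, (u \in B) && (f u == v) | (v \in B) && (f v == u)].

Lemma addf_graph h B f : graph h -> {in B, forall a, f a != a} -> graph (addf h B f).
Proof.
move=> [hs hi] fB; split=> [u v|u]; rewrite /addf.
  by rewrite hs [X in _ || X]orbC.
rewrite hi /= orbb; apply/negP => /andP[uB].
by apply/negP/fB.
Qed.

Lemma addf_sub h B f : subrel h (addf h B f).
Proof. by move=> u v; rewrite /addf => ->. Qed.

Lemma addf_l h B f a : a \in B -> addf h B f a (f a).
Proof. by move=> aB; rewrite /addf aB eqxx /= orbT. Qed.

Lemma addf_r h B f a : a \in B -> addf h B f (f a) a.
Proof. by move=> aB; rewrite /addf aB eqxx /= !orbT. Qed.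

Lemma addf_vol h B f : vol (addf h B f) <= vol h + 2 * #|B|.
Proof.
have -> : 2 * #|B| = \sum_v (v \in B) + \sum_v #|[set a in B | f a == v]|.
  have -> : \sum_v (v \in B) = #|B| by rewrite -big_mkcond sum1_card.
  have -> : \sum_v #|[set a in B | f a == v]| = #|B|.
    rewrite -[RHS]sum1_card [RHS](partition_big f xpredT) //=; apply: eq_bigr => v _.
    by rewrite -sum1_card; apply: eq_bigl => a; rewrite inE.
  by rewrite mul2n addnn.
rewrite /vol -!big_split /=; apply: leq_sum => v _.
have -> : ((v \in B) : nat) = #|[set u in [set f v] | v \in B]|.
  case vB: (v \in B); last by rewrite /= -(cards0 X); apply: eq_card => u; rewrite !inE andbF.
  by rewrite /= -(cards1 (f v)); apply: eq_card => u; rewrite !inE andbT.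
apply: leq_trans (_ : #|nb h v :|: ([set u in [set f v] | v \in B] :|: [set a in B | f a == v])| <= _).
  apply/subset_leq_card/subsetP => u; rewrite !inE /addf.
  by rewrite andbC [_ == u]eq_sym.
rewrite (leq_trans (leq_card_setU _ _).1) // leq_add2l.
by rewrite (leq_trans (leq_card_setU _ _).1).
Qed.

(* If some y splits A, join it to its non-neighbours in A and recurse on the
   rest; otherwise A consists of twins and missing pairs in their common closed
   neighbourhood are added. *)
Lemma layer t h A : graph h -> A != set0 -> {in A, forall a, t <= #|nb h a|} ->
  exists h', [/\ graph h', subrel h h', vol h' + 2 <= vol h + 2 * #|A| &
    {in A, forall a, t * t.-1 <= wt h' a \/ wt h a + 2 * #|nb h a :&: A| <= wt h' a}].
Proof.
move: {2}#|A| (leqnn #|A|) => n; elim: n h A => [|n IH] h A leA gh A0 tA.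
  by move: A0; rewrite -card_gt0; lia.
have [hs hi] := gh.
have [/existsP[y /andP[/set0Pn[a1 a1P] /set0Pn[a0 a0P]]]|nosplit] :=
  boolP [exists y, (A :\: (y |: nb h y) != set0) && (A :&: (y |: nb h y) != set0)].
  set A1 := A :\: _ in a1P; set A0' := A :&: _ in a0P.
  have yA1 : y \notin A1 by rewrite !inE eqxx.
  have cA : #|A| = #|A1| + #|A0'| by rewrite -(cardsID (y |: nb h y) A) addnC.
  have A1gt : 0 < #|A1| by apply/card_gt0P; exists a1.
  pose h1 := addf h A1 (fun=> y).
  have gh1 : graph h1.
    by apply: addf_graph => // a aA; apply: contraNneq yA1 => ->.
  have sh1 : subrel h h1 by apply: addf_sub.
  have [] := IH h1 A0'.
  - lia.
  - by [].
  - by apply/set0Pn; exists a0.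
  - move=> a; rewrite !inE => /andP[aA _]; apply: leq_trans (tA a aA) _.
    exact/subset_leq_card/sub_nb.
  move=> h' [gh' sh' vh' wh']; exists h'; split=> //.
  - by move=> u v /sh1 /sh'.
  - have := addf_vol h A1 (fun=> y); rewrite -/h1; lia.
  (* Joining [a] in [A1] to [y] pays for [a] at once: each neighbour of [a] in [A] is now adjacent
     to [y], either as a member of [A1] or as an old neighbour of [y]. *)
  move=> a aA; have [aA1|naA1] := boolP (a \in A1).
    right; apply: leq_trans (wt_sub a sh'); apply: (@wt_gain _ _ _ _ y) => //.
    - by apply: (@addf_l h A1 (fun=> y)).
    - apply/subsetP => c; rewrite !inE => /andP[hac cA']; rewrite sh1 //=.
      have [cA1|] := boolP (c \in A1); first by apply: (@addf_r h A1 (fun=> y)).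
      rewrite !inE cA' andbT negbK => /orP[/eqP ecy|hyc]; last by apply: sh1.
      by move: aA1; rewrite !inE -ecy hs hac orbT.
    - move=> c _; move: aA1; rewrite !inE => /andP[/norP[_ nya] _].
      by rewrite hs (negPf nya).
  have aA0 : a \in A0' by move: naA1; rewrite !inE aA andbT negbK.
  have /orP[/eqP eay|hya] : (a == y) || h y a by move: aA0; rewrite !inE aA.
    have [->|wa] := wh' _ aA0; first by left.
    right; apply: leq_trans wa; apply: leq_add; first exact: wt_sub.
    rewrite leq_mul2l /=; apply/subset_leq_card/subsetP => c; rewrite !inE eay.
    by move=> /andP[hyc ->]; rewrite hyc sh1 //= orbT.
  (* A neighbour [a] of [y] gains the triangles through [y] and its neighbours in [A1]; the
     recursion accounts for its neighbours in [A0']. *)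
  have [->|wa] := wh' _ aA0; first by left.
  right; apply: leq_trans wa.
  have g1 : wt h a + 2 * #|nb h a :&: A1| <= wt h1 a.
    apply: (@wt_gain _ _ _ _ y) => //.
    - by rewrite sh1 // hs.
    - apply/subsetP => c; rewrite in_setI => /andP[]; rewrite !inE => hac cA1.
      by rewrite sh1 //=; apply: (@addf_r h A1 (fun=> y)); rewrite !inE.
    - by move=> c; rewrite !inE => /andP[_ /andP[/norP[_ /negPf->]]]; rewrite !andbF.
  have : #|nb h a :&: A| <= #|nb h a :&: A1| + #|nb h1 a :&: A0'|.
    apply: leq_trans (_ : #|(nb h a :&: A1) :|: (nb h1 a :&: A0')| <= _); last exact: (leq_card_setU _ _).1.
    apply/subset_leq_card/subsetP => c; rewrite !inE => /andP[hac ->].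
    by rewrite hac (sh1 _ _ hac) /= andbT; case: (c == y); case: (h y c).
  lia.
(* As no [y] splits [A], all members of [A] have the same closed neighbourhood, called [M] below. *)
have twin y a b : a \in A -> b \in A -> a \in y |: nb h y -> b \in y |: nb h y.
  move=> aA bA ay; apply: contraR nosplit => nby; apply/existsP; exists y.
  by apply/andP; split; apply/set0Pn; [exists b | exists a]; rewrite inE ?nby ?ay ?aA ?bA.
have /set0Pn[a0 a0A] := A0.
pose M := a0 |: nb h a0.
have NM a : a \in A -> a |: nb h a = M.
  move=> aA; apply/setP=> y.
  have sy (c : X) : (y \in c |: nb h c) = (c \in y |: nb h y) by rewrite !inE eq_sym hs.
  by rewrite /M !sy; apply/idP/idP; apply: twin.
(* A missing pair in [M] avoids [A], so adding it creates a triangle at every vertex of [A]. Once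
   [M] is complete, it is a clique with more than [t] vertices. Since no vertex is its own
   neighbour, [k = #|A|.-1] suffices. *)
suff key k : exists h', [/\ graph h', subrel h h', vol h' <= vol h + 2 * k,
    {in A, forall a, a |: nb h' a = M} &
    {in A, forall a, t * t.-1 <= wt h' a \/ wt h a + 2 * k <= wt h' a}].
  have [h' [gh' sh' vh' _ wh']] := key #|A|.-1; exists h'; split=> //.
    have A1 : 0 < #|A| by rewrite card_gt0.
    by lia.
  move=> a aA; have [->|wa] := wh' a aA; first by left.
  right; apply: leq_trans wa; rewrite leq_add2l leq_mul2l /=.
  have -> : #|A|.-1 = #|A :\ a| by rewrite (cardsD1 a A) aA.
  apply/subset_leq_card/subsetP => c; rewrite !inE => /andP[hac ->]; rewrite andbT.
  by apply: contraTneq hac => ->; rewrite hi.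
elim: k => [|k [h' [gh' sh' vh' Mh' wh']]].
  by exists h; split=> //; [lia | move=> a _; right; lia].
have [hs' hi'] := gh'.
have [/existsP[p /existsP[q /and4P[pM qM pq npq]]]|complete] :=
  boolP [exists p, exists q, [&& p \in M, q \in M, p != q & ~~ h' p q]].
  pose h2 := addf h' [set q] (fun=> p).
  have gh2 : graph h2 by apply: addf_graph => // a; rewrite inE => /eqP->.
  have sh2 : subrel h' h2 by apply: addf_sub.
  have nA c d a : c \in M -> d \in M -> c != d -> ~~ h' c d -> a \in A -> a != c.
    move=> cM dM cd ncd aA; apply: contraNneq ncd => eac; move: dM.
    by rewrite -(Mh' _ aA) eac !inE eq_sym (negPf cd).
  have Ap a : a \in A -> a != p by apply: (nA p q).
  have Aq a : a \in A -> a != q by apply: (nA q p); rewrite // 1?eq_sym // hs'.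
  have hM a c : a \in A -> c \in M -> a != c -> h' a c.
    by move=> aA; rewrite -(Mh' _ aA) !inE eq_sym => /orP[->|].
  exists h2; split=> //.
  - by move=> u v /sh' /sh2.
  - by have := addf_vol h' [set q] (fun=> p); rewrite -/h2 cards1; lia.
  - move=> a aA; rewrite -[RHS](Mh' _ aA); apply/setP=> c; rewrite !inE /h2 /addf !inE.
    by rewrite [p == a]eq_sym (negPf (Ap _ aA)) (negPf (Aq _ aA)) andbF !orbF.
  move=> a aA; have [wa|wa] := wh' a aA.
    by left; apply: leq_trans wa _; apply: wt_sub.
  right; rewrite mulnS addnCA addnC; apply: leq_trans (_ : wt h' a + 2 * #|[set q]| <= _).
    by rewrite cards1 muln1 leq_add2r.
  apply: (@wt_gain _ _ _ _ p) => //.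
  - by apply: sh2; apply: hM; rewrite ?Ap.
  - rewrite sub1set !inE sh2 /=; last by apply: hM; rewrite ?Aq.
    by apply: (@addf_r h' [set q] (fun=> p)); rewrite inE.
  - by move=> c; rewrite inE => /eqP->; rewrite (negPf npq) !andbF.
exists h'; split=> // [|a aA]; first by lia.
left; apply: leq_trans (@cliq_wt _ h' M a _ _).
- have : t.+1 <= #|M|.
    rewrite -(NM a aA) cardsU1 !inE hi add1n ltnS.
    exact: tA.
  by move=> tM; apply: leq_mul; lia.
- move=> p q pM qM pq; apply: contraR complete => npq.
  by apply/existsP; exists p; apply/existsP; exists q; apply/and4P.
- by rewrite -(NM a aA) !inE eqxx.
Qed.

End Add.

(** * Detaching cliques and reattaching them *)

Section EdgeCount.
Variable X : finType.
Implicit Types (g h : rel X) (A B C S : {set X}).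

Definition ee g A B := \sum_(u in A) #|B :&: nb g u|.

Lemma eeC g A B : symmetric g -> ee g A B = ee g B A.
Proof.
move=> gs; rewrite /ee (eq_bigr (fun u => \sum_(v in B) (g u v : nat))); last first.
  move=> u _; rewrite -sum1_card big_mkcond [RHS]big_mkcond /=; apply: eq_bigr => v _.
  by rewrite !inE; case: (v \in B); case: (g u v).
rewrite exchange_big /=; apply: eq_bigr => v _.
rewrite -sum1_card big_mkcond [RHS]big_mkcond /=; apply: eq_bigr => u _.
by rewrite !inE gs; case: (u \in A); case: (g v u).
Qed.

Lemma eeUl g A B C : [disjoint A & B] -> ee g (A :|: B) C = ee g A C + ee g B C.
Proof.
by move=> AB; rewrite /ee -bigU //=; apply: eq_bigl => u; rewrite !inE.
Qed.

Lemma eeUr g A B C : [disjoint A & B] -> ee g C (A :|: B) = ee g C A + ee g C B.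
Proof.
move=> AB; rewrite /ee -big_split /=; apply: eq_bigr => u _.
rewrite setIUl cardsU -[in RHS](subn0 (_ + _)); congr (_ - _).
apply/eqP; rewrite cards_eq0 -subset0; apply/subsetP => v; rewrite !inE => /andP[/andP[vA _] /andP[vB _]].
by have := disjointFr AB vA; rewrite vB.
Qed.

Lemma wt_ee g v : wt g v = ee g (nb g v) (nb g v).
Proof. exact: wtE. Qed.

Lemma ee_cliq g S : irreflexive g -> ee g S S <= #|S| * #|S|.-1.
Proof.
move=> gi; rewrite /ee -sum_nat_const; apply: leq_sum => u uS.
rewrite (cardsD1 u S) uS /=; apply/subset_leq_card/subsetP => v; rewrite !inE.
by case/andP=> -> guv; rewrite andbT; apply: contraTneq guv => ->; rewrite gi.
Qed.

Lemma cliq_ee g S : cliq g S -> #|S| * #|S|.-1 <= ee g S S.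
Proof.
move=> cS; rewrite /ee -sum_nat_const; apply: leq_sum => u uS.
rewrite (cardsD1 u S) uS /=; apply/subset_leq_card/subsetP => v; rewrite !inE.
by case/andP=> vu vS; rewrite vS cS // eq_sym.
Qed.

Lemma volE g : vol g = ee g setT setT.
Proof. by apply: eq_big => [v|v _]; rewrite ?inE ?setTI. Qed.

Lemma leq_ee g A B A' B' : A \subset A' -> B \subset B' -> ee g A B <= ee g A' B'.
Proof.
move=> sA sB; rewrite {2}/ee (big_setID A) /= (setIidPr sA); apply: leq_trans (leq_addr _ _).
by apply: leq_sum => u _; apply/subset_leq_card/setSI.
Qed.

Lemma leq_ee_rel g h A B : {in A & B, forall u v, g u v -> h u v} -> ee g A B <= ee h A B.
Proof.
move=> gh; apply: leq_sum => u uA; apply/subset_leq_card/subsetP => v.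
by rewrite !inE => /andP[vB guv]; rewrite vB gh.
Qed.

End EdgeCount.

Section Attach.
Variables (X : finType) (K1 K2 : {set X}).
Implicit Types (g h : rel X) (d : X -> nat) (A B C S : {set X}).
Hypothesis K12 : [disjoint K1 & K2].

Let U := K1 :|: K2.

Definition outer g : rel X := fun u v => [&& g u v, u \in ~: U & v \in ~: U].
(* [att h d] joins [u] outside to the first [d u] vertices of [K1]; as these sets
   are nested, [u] and [v] get [minn (d u) (d v)] common neighbours in [K1]. *)
Definition col k := [set v in K1 | index v (enum K1) < k].
Definition att h d : rel X := fun u v =>
  [|| h u v,
      [&& u \in ~: U, v \in K1 & index v (enum K1) < d u],
      [&& v \in ~: U, u \in K1 & index u (enum K1) < d v],
      [&& u \in K1, v \in K1 & u != v] |
      [&& u \in K2, v \in K2 & u != v]].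
Definition supp h := forall u v, h u v -> u \in ~: U /\ v \in ~: U.

Lemma col_card k : #|col k| = minn k #|K1|.
Proof.
rewrite [#|K1|]cardE -size_take_min.
have uq : uniq (take k (enum K1)) by rewrite take_uniq ?enum_uniq.
rewrite -(card_uniqP uq); apply: eq_card => v; rewrite inE.
have [vK|vK] := boolP (v \in K1); last first.
  by apply/esym/negbTE; apply: contra vK => /mem_take; rewrite mem_enum.
by rewrite in_take ?mem_enum.
Qed.

Lemma colI k l : col k :&: col l = col (minn k l).
Proof. by apply/setP=> v; rewrite !inE leq_min; case: (v \in K1). Qed.

Lemma col_sub k : col k \subset K1.
Proof. by apply/subsetP => v; rewrite inE => /andP[]. Qed.

Lemma outer_graph g : graph g -> graph (outer g).
Proof.
move=> [gs gi]; split=> [u v|u]; rewrite /outer ?gi //.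
by rewrite gs; congr (_ && _); rewrite andbC.
Qed.

Lemma outer_supp g : supp (outer g).
Proof. by move=> u v /and3P[]. Qed.

Lemma att_graph h d : graph h -> graph (att h d).
Proof.
move=> [hs hi]; split=> [u v|u]; rewrite /att; last first.
  by rewrite hi eqxx !andbF !orbF /U !inE; case: (u \in K1) => //=; rewrite !andbF.
rewrite hs [v == u]eq_sym; congr (_ || _); rewrite orbCA.
by do 3!congr (_ || _); rewrite andbCA.
Qed.

Lemma att_nbO h d z : supp h -> z \in ~: U -> nb (att h d) z = nb h z :|: col (d z).
Proof.
move=> sh zU; apply/setP=> v; rewrite !inE /att zU /=.
have : z \notin K1 /\ z \notin K2 by move: zU; rewrite !inE => /norP.
by case=> /negPf-> /negPf->; rewrite !andbF !orbF.
Qed.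

Lemma att_sub h d : subrel h (att h d).
Proof. by move=> u v; rewrite /att => ->. Qed.

Lemma supp_disj h z k : supp h -> [disjoint nb h z & col k].
Proof.
move=> sh; rewrite -setI_eq0; apply/eqP/setP=> v; rewrite !inE.
by apply/negP => /and3P[/sh[_]]; rewrite !inE => /norP[/negPf->].
Qed.

(** The three terms count pairs of neighbours of [z] outside the cliques, mixed pairs, and pairs
    inside [K1]. *)
Lemma att_wt h d z : graph h -> supp h -> z \in ~: U ->
  {in ~: U, forall u, d u <= #|K1|} ->
  wt h z + 2 * \sum_(u in nb h z) minn (d z) (d u) + d z * (d z).-1 <= wt (att h d) z.
Proof.
move=> gh sh zU dK; have [as_ ai] := att_graph d gh.
rewrite [wt (att _ _) _]wt_ee att_nbO // eeUl ?supp_disj // !eeUr ?supp_disj //.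
rewrite [ee _ (col _) (nb h z)]eeC //.
have cz : #|col (d z)| = d z by rewrite col_card (minn_idPl _) ?dK.
have h1 : wt h z <= ee (att h d) (nb h z) (nb h z).
  by rewrite wt_ee; apply: leq_ee_rel => u v _ _; apply: att_sub.
have h2 : \sum_(u in nb h z) minn (d z) (d u) <= ee (att h d) (nb h z) (col (d z)).
  apply: leq_sum => u; rewrite inE => /sh[_ uU].
  rewrite att_nbO // setIUr colI; apply: leq_trans (subset_leq_card (subsetUr _ _)).
  by rewrite col_card leq_min leqnn geq_min dK.
have h3 : d z * (d z).-1 <= ee (att h d) (col (d z)) (col (d z)).
  rewrite -{1 2}cz; apply: cliq_ee => u v uK vK uv.
  by rewrite /att (subsetP (col_sub _) _ uK) (subsetP (col_sub _) _ vK) uv !orbT.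
by lia.
Qed.

Lemma att_deg h d z : supp h -> z \in ~: U -> d z <= #|K1| ->
  #|nb h z| + d z <= #|nb (att h d) z|.
Proof.
move=> sh zU dK; rewrite att_nbO // cardsU (disjoint_setI0 (supp_disj _ _ sh)) cards0 subn0.
by rewrite col_card (minn_idPl dK).
Qed.

Lemma vol_split g : symmetric g ->
  vol g = ee g (~: U) (~: U) + ee g K1 K1 + ee g K2 K2
          + 2 * (ee g (~: U) K1 + ee g (~: U) K2 + ee g K1 K2).
Proof.
move=> gs; have dU : [disjoint U & ~: U] by rewrite -setI_eq0 setICr.
rewrite volE -(setUCr U) !(eeUl, eeUr) //.
by rewrite ![ee g _ (~: U)]eeC // [ee g K2 K1]eeC //; lia.
Qed.

(** The terms for edges inside the two cliques recur in [outer_vol] and cancel when the new graph is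
    compared with [g]. *)
Lemma att_vol h d : graph h -> supp h ->
  vol (att h d) <= vol h + 2 * \sum_(z in ~: U) d z + #|K1| * #|K1|.-1 + #|K2| * #|K2|.-1.
Proof.
move=> gh sh; have [as_ ai] := att_graph d gh.
rewrite vol_split //.
have h1 : ee (att h d) (~: U) (~: U) <= vol h.
  rewrite volE; apply: leq_trans (leq_ee h (subsetT _) (subsetT _)); apply: leq_ee_rel => u v uR vR.
  move: uR vR; rewrite !inE => /norP[/negPf u1 /negPf u2] /norP[/negPf v1 /negPf v2].
  by rewrite /att !inE u1 u2 v1 v2 !andbF !orbF.
have h2 : ee (att h d) (~: U) K1 <= \sum_(z in ~: U) d z.
  apply: leq_sum => u uU; rewrite att_nbO // setIUr.
  have -> : K1 :&: nb h u = set0.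
    apply/setP=> v; rewrite !inE; apply/negP => /andP[vK /sh[_]].
    by rewrite !inE vK.
  rewrite set0U; apply: leq_trans (subset_leq_card (subsetIr _ _)) _.
  by rewrite col_card geq_minl.
have h3 : ee (att h d) (~: U) K2 = 0.
  rewrite /ee big1 // => u uU; rewrite att_nbO //; apply/eqP; rewrite cards_eq0.
  apply/eqP/setP => v; rewrite !inE; apply/negP => /andP[vK /orP[/sh[_]|/andP[vK1 _]]].
    by rewrite !inE vK orbT.
  by move: (disjointFr K12 vK1); rewrite vK.
have h4 : ee (att h d) K1 K2 = 0.
  rewrite /ee big1 // => u uK; apply/eqP; rewrite cards_eq0.
  apply/eqP/setP => v; rewrite !inE /att !inE uK (disjointFr K12 uK) /=.
  apply/negP => /andP[vK]; rewrite vK orbT (disjointFl K12 vK) /= orbF => /sh[].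
  by rewrite !inE uK.
by have := ee_cliq K1 ai; have := ee_cliq K2 ai; lia.
Qed.

Definition dg g A z := #|nb g z :&: A|.

Lemma outer_vol g : graph g -> cliq g K1 -> cliq g K2 ->
  vol (outer g) + 2 * \sum_(z in ~: U) (dg g K1 z + dg g K2 z) + #|K1| * #|K1|.-1
    + #|K2| * #|K2|.-1 + 2 * ee g K1 K2 <= vol g.
Proof.
move=> [gs gi] c1 c2; rewrite [in X in _ <= X]vol_split // big_split /=.
have h1 : vol (outer g) <= ee g (~: U) (~: U).
  rewrite /vol /ee (bigID (fun u => u \in ~: U)) /= [X in _ + X]big1 ?addn0; last first.
    move=> u nu; apply/eqP; rewrite cards_eq0; apply/eqP/setP=> v.
    by rewrite !inE /outer (negPf nu) !andbF.
  apply: leq_sum => u uU; apply/subset_leq_card/subsetP=> v; rewrite [v \in nb (outer g) u]inE in_setI.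
  by case/and3P=> guv _ ->; rewrite inE guv.
have h2 A : \sum_(z in ~: U) dg g A z = ee g (~: U) A.
  by apply: eq_bigr => z _; rewrite /dg setIC.
by rewrite !h2; have := cliq_ee c1; have := cliq_ee c2; lia.
Qed.

(** Two vertices share in a clique at most the smaller of their degrees into it. The nested sets of
    [att] attain this bound, so reattaching with the same degrees costs no triangle. *)
Lemma outer_wt g z : graph g -> z \in ~: U ->
  wt g z <= wt (outer g) z
    + 2 * \sum_(u in nb (outer g) z) (minn (dg g K1 z) (dg g K1 u) + minn (dg g K2 z) (dg g K2 u))
    + dg g K1 z * (dg g K1 z).-1 + dg g K2 z * (dg g K2 z).-1
    + 2 * ee g (nb g z :&: K1) (nb g z :&: K2).
Proof.
move=> gg zU; have [gs gi] := gg.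
have nbE : nb g z = nb (outer g) z :|: (nb g z :&: K1 :|: nb g z :&: K2).
  apply/setP=> v; rewrite !inE /outer zU !inE /=.
  by case: (g z v); case: (v \in K1); case: (v \in K2).
have d1 : [disjoint nb (outer g) z & (nb g z :&: K1 :|: nb g z :&: K2)].
  rewrite -setI_eq0; apply/eqP/setP=> v; rewrite !inE /outer !inE.
  by case: (v \in K1); case: (v \in K2); rewrite ?andbF.
have d2 : [disjoint nb g z :&: K1 & nb g z :&: K2].
  rewrite -setI_eq0; apply/eqP/setP=> v; rewrite !inE.
  case v1: (v \in K1); rewrite ?andbF //.
  by rewrite (disjointFr K12 v1) !andbF.
rewrite [wt g z]wt_ee {1 2}nbE !(eeUl, eeUr) //.
rewrite [ee g (nb g z :&: K1) (nb (outer g) z)]eeC // [ee g (nb g z :&: K2) (nb (outer g) z)]eeC // [ee g (nb g z :&: K2) (nb g z :&: K1)]eeC //.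
have h1 : ee g (nb (outer g) z) (nb (outer g) z) <= wt (outer g) z.
  rewrite wt_ee; apply: leq_ee_rel => u v; rewrite !inE /outer => /and3P[_ _ ->] /and3P[_ _ ->].
  by move=> ->.
have h2 A : ee g (nb (outer g) z) (nb g z :&: A) <= \sum_(u in nb (outer g) z) minn (dg g A z) (dg g A u).
  apply: leq_sum => u _; rewrite leq_min; apply/andP; split; apply/subset_leq_card/subsetP=> v.
    by rewrite !inE => /andP[].
  by rewrite !inE => /andP[/andP[_ ->] ->].
have := h2 K1; have := h2 K2.
have := ee_cliq (nb g z :&: K1) gi; have := ee_cliq (nb g z :&: K2) gi.
by rewrite big_split /= /dg; lia.
Qed.

Lemma outer_deg g z : z \in ~: U -> #|nb g z| = #|nb (outer g) z| + dg g K1 z + dg g K2 z.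
Proof.
move=> zU; rewrite /dg -addnA.
have -> : #|nb g z :&: K1| + #|nb g z :&: K2| = #|nb g z :&: U|.
  rewrite setIUr cardsU; have -> : nb g z :&: K1 :&: (nb g z :&: K2) = set0.
    by rewrite setIACA (disjoint_setI0 K12) setI0.
  by rewrite cards0 subn0.
rewrite -(cardsID U (nb g z)) addnC; congr (#|pred_of_set _| + _).
by apply/setP=> v; rewrite !inE /outer zU !inE /= andbC.
Qed.

End Attach.

(** * Extremal graphs without isolated cliques *)

Lemma falling2D a b : (a + b) * (a + b).-1 = a * a.-1 + b * b.-1 + 2 * (a * b).
Proof. by case: a => [|a]; case: b => [|b] /=; rewrite ?muln0 ?mul0n ?addn0 //=; lia. Qed.

(** By [a + b - 1 <= a * b], the mixed pairs created by a merger pay for one dropped edge. *)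
Lemma falling2D_pred a b : 0 < a -> 0 < b ->
  a * a.-1 + b * b.-1 <= (a + b - 1) * (a + b - 1).-1.
Proof.
move=> a0; case: b => // b _; rewrite addnS subn1 falling2D /=.
have : b <= a * b by rewrite leq_pmull.
by case: b => [|b] /=; lia.
Qed.

(** A dropped edge costs [2 * a.-1]. For [b > 0] the product [2 * (a.-1 * b)] pays for it; for
    [b = 0] the common neighbours with a vertex of degree [c] into the clique do. *)
Lemma falling2_pred a b c : 0 < a -> a <= c.+1 ->
  a * a.-1 + b * b.-1 <= 2 * (if b == 0 then minn a.-1 c else 0) + (a.-1 + b) * (a.-1 + b).-1.
Proof.
case: a => // a _; rewrite ltnS /= => ac; rewrite falling2D (minn_idPl ac).
by case: b => [|b] /=; case: a ac => [|a] _ /=; lia.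
Qed.

Lemma minn_pred a a' b b' :
  minn a b + minn a' b' <= minn (a.-1 + a') (b.-1 + b') + ((0 < a) && (0 < b)).
Proof. by case: a b => [|a] [|b] /=; lia. Qed.

Lemma minn_shift a b c :
  minn a 0 + minn b c + (if b == 0 then minn a.-1 c else 0) <= minn (a.-1 + b) (0.-1 + c).
Proof. by rewrite minn0 /=; case: b => [|b] /=; lia. Qed.

(** Truncation at [m - 2] costs at most [4 * m - 6] in pairs inside the clique and [4 * Q.-1] in
    mixed pairs, together at most [4 * D]; the [c] triangles along a new edge return [2 * c]. *)
Lemma falling2_trunc a b m Q D c E E' : 1 < m -> m <= a.+1 -> a <= m -> b = minn a (m - 2) ->
  E <= E' + 2 * Q.-1 -> m + Q.-1 <= D -> 2 * D <= c ->
  2 * E + a * a.-1 <= 2 * c + 2 * E' + b * b.-1.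
Proof.
case: m => [|[|m]] // _; rewrite !subSS subn0 ltnS => ma am eb; rewrite {}eb => h1 h2 h3.
rewrite (minn_idPr _) ?(leq_trans _ ma) //.
have q : a * a.-1 <= m.+2 * m.+1 by apply: leq_mul => //; lia.
by move: q h1 h2 h3; case: m {ma am} => [|m] /=; clear; lia.
Qed.

Lemma minn_trunc a u m : m <= a.+1 -> a <= m -> u <= m ->
  minn a u <= minn (minn a (m - 2)) (minn u (m - 2)) + 2 * (m <= u.+1).
Proof. by clear; lia. Qed.

Lemma minn_low a u m : a.+1 < m -> minn a u <= minn (minn a (m - 2)) (minn u (m - 2)).
Proof. by clear; lia. Qed.

(* The maximum of the right-hand side of [h] over the remaining constraints is
   [1456/6 * t^2 < 243 * t^2], attained at [q = 0]. *)
Lemma charge_ineq t p u w q : 23 < t -> p = u + w -> p <= t + q ->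
  255 * (t * t) <= 288 * t + 176 * (u * t) + 256 * (w * p) -> 5 * t <= 6 * (w + 5 * q).
Proof.
move=> t24 ep pq h; rewrite leqNgt; apply/negP => lt.
have h1 : u * t + w * t <= t * t + q * t by rewrite -!mulnDl leq_mul2r; lia.
have h2 : w * p <= w * t + w * q by rewrite -mulnDr leq_mul2l; lia.
have h3 : 6 * (w * t) + 30 * (q * t) <= 5 * (t * t).
  by have : (6 * (w + 5 * q)) * t <= (5 * t) * t; [rewrite leq_mul2r; lia | clear; lia].
have h4 : 6 * (w * q) + 30 * (q * q) <= 5 * (t * q).
  by have : (6 * (w + 5 * q)) * q <= (5 * t) * q; [rewrite leq_mul2r; lia | clear; lia].
have h5 : 24 * t <= t * t by rewrite leq_mul2r; lia.
by move: h h1 h2 h3 h4 h5 t24; rewrite [t * q]mulnC; clear; lia.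
Qed.

(** * Minimal graphs and their good cliques *)

Section Extremal.
Variables (X : finType) (t : nat) (g : rel X).
Implicit Types (h : rel X) (A B C S K L : {set X}) (d : X -> nat).
Hypothesis t2 : 1 < t.
Hypothesis gg : graph g.
Hypothesis gW : forall v, t * t.-1 <= wt g v.
Hypothesis gmin : forall h, graph h -> (forall v, t * t.-1 <= wt h v) -> vol g <= vol h.
Hypothesis niso : forall S : {set X}, #|S| = t.+1 -> {in S, forall v, nb g v = S :\ v} -> False.

Lemma deg_ge v : t <= #|nb g v|.
Proof.
rewrite leqNgt; apply/negP => dt; have := leq_trans (gW v) (wt_le v gg).
by rewrite leqNgt => /negP; apply; apply: ltn_mul => //; lia.
Qed.

Lemma low_cliq v : #|nb g v| = t -> cliq g (v |: nb g v) /\ #|v |: nb g v| = t.+1.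
Proof.
move=> dv; split; last by rewrite cardsU1 !inE (graph_irr gg) dv.
apply: wt_full => //; apply/eqP; rewrite eqn_leq wt_le //=.
by have := gW v; rewrite dv.
Qed.

Lemma cliq_sat h S v : cliq h S -> #|S| = t.+1 -> v \in S -> t * t.-1 <= wt h v.
Proof. by move=> cS eS vS; have := cliq_wt cS vS; rewrite eS. Qed.

(** [layer] repairs all of [A] with at most [#|A| - 1] edges, so a saving of [#|A|] edges
    contradicts minimality. *)
Lemma layer_gain h A : graph h -> A != set0 -> {in A, forall a, t <= #|nb h a|} ->
  (forall v, v \notin A -> t * t.-1 <= wt h v) ->
  {in A, forall a, t * t.-1 <= wt h a + 2 * #|nb h a :&: A|} ->
  vol h + 2 * #|A| <= vol g -> False.
Proof.
move=> gh A0 tA nA wA vh; have [h' [gh' sh' vh' wh']] := layer gh A0 tA.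
have : vol g <= vol h'; last by lia.
apply: gmin => // v; have [vA|vA] := boolP (v \in A); last first.
  by apply: leq_trans (nA v vA) _; apply: wt_sub.
by have [//|] := wh' v vA; apply: leq_trans; apply: wA.
Qed.

Definition excl K := \sum_(z in ~: K) dg g K z.

(** The good cliques. With the factor 16, any [t / 8] common neighbours number at least twice the
    edges leaving [K], which is what [unfixable] needs. *)
Definition gc K := [/\ #|K| = t.+1, cliq g K & 16 * excl K <= t].

Lemma dg_le K z : z \notin K -> dg g K z <= excl K.
Proof. by move=> zK; rewrite /excl (bigD1 z) ?inE //= leq_addr. Qed.

Lemma dg_gt0 K z w : w \in K -> g z w -> 0 < dg g K z.
Proof. by move=> wK gzw; apply/card_gt0P; exists w; rewrite !inE gzw wK. Qed.

Lemma excl_gt0 K : gc K -> 0 < excl K.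
Proof.
case=> eK cK _; rewrite lt0n; apply/eqP => e0; apply: (niso eK) => v vK.
apply/setP=> u; rewrite !inE; apply/idP/andP => [gvu|[uv uK]]; last by rewrite cK // eq_sym.
split; first by apply: contraTneq gvu => ->; rewrite (graph_irr gg).
apply/negPn/negP => uK; have := dg_le uK; rewrite e0 leqn0 => /eqP e.
by have := @dg_gt0 K u v vK; rewrite e (graph_sym gg) => /(_ gvu).
Qed.

(** All of [L :&: K] is adjacent to a vertex of [L] outside [K], and each vertex of [L :\: K] sends
    an edge into [K]. Both parts thus have at most [excl K] elements, too few for [t + 1] in
    total. *)
Lemma cliq_meet K L : gc K -> cliq g L -> #|L| = t.+1 -> L :&: K != set0 -> L :\: K != set0 -> False.
Proof.
case=> eK cK sK cL eL /set0Pn[w /setIP[wL wK]] /set0Pn[z /setDP[zL zK]].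
have h1 : #|L :&: K| <= excl K.
  apply: leq_trans (dg_le zK); apply/subset_leq_card/subsetP=> v; rewrite !inE => /andP[vL vK].
  by rewrite vK andbT cL //; apply: contraNneq zK => ->.
have h2 : #|L :\: K| <= excl K.
  rewrite /excl (big_setID (L :\: K)) /=; apply: leq_trans (leq_addr _ _).
  have -> : ~: K :&: (L :\: K) = L :\: K by apply/setP=> v; rewrite !inE; case: (v \in K).
  rewrite -sum1_card; apply: leq_sum => v; rewrite inE => /andP[vK vL].
  by apply: (dg_gt0 wK); apply: cL => //; apply: contraNneq vK => ->.
by have := cardsID K L; lia.
Qed.

Lemma gc_disj K L : gc K -> gc L -> K != L -> [disjoint K & L].
Proof.
move=> gK gL nKL; rewrite -setI_eq0; apply/negPn/negP => KL.
have [eL cL _] := gL; have [eK _ _] := gK.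
apply: (cliq_meet gK cL eL); first by rewrite setIC.
apply: contra nKL; rewrite setD_eq0 => sLK; rewrite eq_sym eqEcard sLK.
by rewrite eL eK leqnn.
Qed.

(** Otherwise the closed neighbourhood of [z] would be a clique of size [t + 1] meeting [K] and
    leaving it. The strict inequality is what later allows [z] to lose an edge. *)
Lemma nbr_high K z : gc K -> z \notin K -> 0 < dg g K z -> t < #|nb g z|.
Proof.
move=> gK zK dz; rewrite ltn_neqAle deg_ge andbT; apply/eqP => e.
have [cL eL] := low_cliq (esym e).
apply: (cliq_meet gK cL eL).
  by have /card_gt0P[w] := dz; rewrite !inE => /andP[a b]; apply/set0Pn; exists w; rewrite !inE a b orbT.
by apply/set0Pn; exists z; rewrite !inE eqxx zK.
Qed.

(** The lower bound given by [att_wt] for the weight of [z] in [att h d]. *)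
Definition tau h d z := wt h z + 2 * \sum_(u in nb h z) minn (d z) (d u) + d z * (d z).-1.

Lemma sum_ind A S : A \subset S -> \sum_(z in S) (z \in A) = #|A|.
Proof.
move=> AS; rewrite -big_mkcondr /= -sum1_card; apply: eq_bigl => z.
by case zA: (z \in A); rewrite ?andbF // (subsetP AS).
Qed.

Lemma sum_indI A S : \sum_(z in S) (z \in A) = #|S :&: A|.
Proof.
by rewrite -big_mkcondr /= -sum1_card; apply: eq_bigl => z; rewrite inE.
Qed.

Lemma addf_supp K1 K2 h B f : supp K1 K2 h ->
  {in B, forall a, a \in ~: (K1 :|: K2) /\ f a \in ~: (K1 :|: K2)} ->
  supp K1 K2 (addf h B f).
Proof.
move=> sh fB u v /or3P[/sh //|/andP[uB /eqP<-]|/andP[vB /eqP<-]]; first exact: fB.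
by have [] := fB v vB.
Qed.

(** * Exchanges at two good cliques, the second possibly empty *)

Section Pair.
Variables K1 K2 : {set X}.
Hypothesis K12 : [disjoint K1 & K2].
Hypothesis gc1 : gc K1.
Hypothesis gc2 : K2 = set0 \/ gc K2.
Let R := ~: (K1 :|: K2).
Let d1 := dg g K1.
Let d2 := dg g K2.
Let g0 := outer K1 K2 g.

(* A saving of [#|A|] edges suffices for nonempty [A], since [layer] makes up for
   the triangles missing at [A] with [#|A| - 1] edges; otherwise a strict saving
   is needed. *)
Lemma att_gain h d A : graph h -> supp K1 K2 h -> {in R, forall u, d u <= t.+1} ->
  A \subset R ->
  {in R, forall z, z \notin A -> t * t.-1 <= tau h d z} ->
  {in A, forall a, t * t.-1 <= tau h d a + 2 * #|nb h a :&: A| /\ t <= #|nb h a| + d a} ->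
  vol h + 2 * \sum_(z in R) d z + 2 * #|A| + (A == set0)
   <= vol g0 + 2 * \sum_(z in R) (d1 z + d2 z) + 2 * ee g K1 K2 -> False.
Proof.
move=> gh sh dt sA nA wA vh; have [e1 c1 _] := gc1.
have c2 : cliq g K2 by have [->|[]] := gc2 => // u v; rewrite inE.
have gh1 := att_graph K1 K2 d gh.
have dK : {in R, forall u, d u <= #|K1|} by rewrite e1.
have v1 := att_vol K12 d gh sh; have v2 := outer_vol K12 gg c1 c2.
have sat v : v \notin A -> t * t.-1 <= wt (att K1 K2 h d) v.
  move=> vA; have [vR|] := boolP (v \in R).
    by apply: leq_trans (nA v vR vA) _; apply: att_wt.
  rewrite inE negbK inE => /orP[vK|vK].
    by apply: (cliq_sat (S := K1)) => // x y xK yK xy; rewrite /att xK yK xy !orbT.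
  have e2 : #|K2| = t.+1 by have [e|[]//] := gc2; rewrite e inE in vK.
  by apply: (cliq_sat (S := K2)) => // x y xK yK xy; rewrite /att xK yK xy !orbT.
have [A0|A0] := boolP (A == set0).
  have : vol g <= vol (att K1 K2 h d).
    by apply: gmin => // v; apply: sat; rewrite (eqP A0) inE.
  by move: vh v1 v2; rewrite A0 (eqP A0) cards0 -/d1 -/d2 -/g0 -/R; lia.
apply: (layer_gain gh1 A0) => //.
- move=> a aA; have aR := subsetP sA _ aA; have [_ ta] := wA a aA.
  by apply: leq_trans ta _; apply: att_deg => //; apply: dK.
- move=> a aA; have aR := subsetP sA _ aA; have [ta _] := wA a aA.
  apply: leq_trans ta _; apply: leq_add; first exact: att_wt.
  by rewrite leq_mul2l /=; apply/subset_leq_card/setSI/sub_nb/att_sub.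
- by move: vh v1 v2; rewrite (negPf A0) -/d1 -/d2 -/g0 -/R; lia.
Qed.

Lemma orig_sat z : z \in R -> t * t.-1 <= wt g0 z
    + 2 * \sum_(u in nb g0 z) (minn (d1 z) (d1 u) + minn (d2 z) (d2 u))
    + d1 z * (d1 z).-1 + d2 z * (d2 z).-1
    + 2 * ee g (nb g z :&: K1) (nb g z :&: K2).
Proof. by move=> zR; apply: leq_trans (gW z) _; apply: outer_wt. Qed.

Lemma g0_graph : graph g0. Proof. exact: outer_graph. Qed.

Lemma d_le z : z \in R -> 16 * d1 z <= t /\ 16 * d2 z <= t.
Proof.
rewrite !inE => /norP[z1 z2]; have [_ _ s1] := gc1; split.
  by apply: leq_trans s1; rewrite leq_mul2l dg_le.
have [e2|[_ _ s2]] := gc2; last by apply: leq_trans s2; rewrite leq_mul2l dg_le.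
by rewrite /d2 /dg e2 setI0 cards0.
Qed.

Lemma d_sum z : z \in R -> d1 z + d2 z <= t.+1.
Proof. by move/d_le; lia. Qed.

Lemma ee_le_dd z : ee g (nb g z :&: K1) (nb g z :&: K2) <= d1 z * d2 z.
Proof.
rewrite /ee /d1 /dg -sum_nat_const; apply: leq_sum => u _.
exact/subset_leq_card/subsetIl.
Qed.

(** Merging the attachments with degrees [d1 + d2] saves every edge between the cliques. Pairs of
    neighbours of [z] across the cliques number at most [d1 z * d2 z], which is the mixed term of
    [falling2D]. *)
Lemma no_cross : ee g K1 K2 = 0.
Proof.
apply/eqP; rewrite -leqn0 leqNgt; apply/negP => e0.
apply: (@att_gain g0 (fun z => d1 z + d2 z) set0 g0_graph).
- exact: outer_supp.
- exact: d_sum.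
- exact: sub0set.
- move=> z zR _; apply: leq_trans (orig_sat zR) _; rewrite /tau.
  have : \sum_(u in nb g0 z) (minn (d1 z) (d1 u) + minn (d2 z) (d2 u)) <=
    \sum_(u in nb g0 z) minn (d1 z + d2 z) (d1 u + d2 u) by apply: leq_sum => u _; lia.
  by have := ee_le_dd z; rewrite falling2D; lia.
- by move=> a; rewrite inE.
- by rewrite cards0 eqxx; lia.
Qed.

Lemma ee_cross0 z : ee g K1 K2 = 0 -> ee g (nb g z :&: K1) (nb g z :&: K2) = 0.
Proof. by move=> e; apply/eqP; rewrite -leqn0 -e leq_ee ?subsetIr. Qed.

(* Merge the two cliques and drop one edge at each such maximiser: the product
   [d1 * d2 >= d1 + d2 - 1] of new triangles pays for it. *)
Lemma overlap_max y : ee g K1 K2 = 0 -> y \in R -> 0 < d1 y -> 0 < d2 y ->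
  {in R, forall u, d1 u + d2 u <= d1 y + d2 y} -> False.
Proof.
have [M eM] : exists M, d1 y + d2 y = M by eexists.
rewrite eM => e0 yR y1 y2 ymax.
pose A := [set z in R | [&& 0 < d1 z, 0 < d2 z & d1 z + d2 z == M]].
pose d z := d1 z + d2 z - (z \in A).
have yA : y \in A by rewrite inE yR y1 y2 eM eqxx.
have AP z : z \in A -> [/\ 0 < d1 z, 0 < d2 z & d1 z + d2 z = M].
  by rewrite inE => /and4P[_ ? ? /eqP].
have nAP z : z \in R -> z \notin A -> d1 z = 0 \/ d2 z = 0 \/ d1 z + d2 z < M.
  move=> zR; rewrite inE zR /= => zA; have := ymax z zR.
  case: (posnP (d1 z)) => [->|h1]; first by left.
  case: (posnP (d2 z)) => [->|h2]; first by right; left.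
  by move=> le; right; right; rewrite ltn_neqAle le andbT; move: zA; rewrite h1 h2.
have sAR : A \subset R by apply/subsetP=> z; rewrite inE => /andP[].
(* A common neighbour can be lost only when both vertices lie in [A]: for [z] in [A] and [u]
   outside, the left side is at most [M - 1]. *)
have phi z u : z \in R -> u \in R -> minn (d1 z) (d1 u) + minn (d2 z) (d2 u) <=
    minn (d z) (d u) + ((z \in A) && (u \in A)).
  move=> zR uR; rewrite /d; have := ymax z zR; have := ymax u uR.
  have [/AP[]|/(nAP _ zR)] := boolP (z \in A); have [/AP[]|/(nAP _ uR)] := boolP (u \in A) => /=; clear; lia.
have g0R z u : u \in nb g0 z -> u \in R by rewrite inE => /and3P[].
apply: (@att_gain g0 d A g0_graph) => //.
- exact: outer_supp.
- by move=> u /d_sum; apply: leq_trans; apply: leq_subr.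
- move=> z zR zA; apply: leq_trans (orig_sat zR) _; rewrite ee_cross0 // /tau.
  have : \sum_(u in nb g0 z) (minn (d1 z) (d1 u) + minn (d2 z) (d2 u)) <=
    \sum_(u in nb g0 z) minn (d z) (d u).
    by apply: leq_sum => u /g0R uR; have := phi z u zR uR; rewrite (negPf zA) addn0.
  have := falling2D (d1 z) (d2 z).
  have -> : d1 z + d2 z = d z by rewrite /d (negPf zA) subn0.
  by lia.
- move=> z zA; have zR := subsetP sAR z zA; have [z1 z2 zM] := AP z zA; split; last first.
    have := outer_deg K12 g zR; rewrite -/d1 -/d2 -/g0 /d zA.
    have : t < #|nb g z| by apply: (nbr_high gc1) z1; move: zR; rewrite !inE => /norP[].
    by lia.
  apply: leq_trans (orig_sat zR) _; rewrite ee_cross0 // /tau.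
  have : \sum_(u in nb g0 z) (minn (d1 z) (d1 u) + minn (d2 z) (d2 u)) <=
    \sum_(u in nb g0 z) minn (d z) (d u) + #|nb g0 z :&: A|.
    rewrite -sum_indI -big_split /=.
    by apply: leq_sum => u /g0R uR; have := phi z u zR uR; rewrite zA.
  have : d1 z * (d1 z).-1 + d2 z * (d2 z).-1 <= d z * (d z).-1.
    by rewrite /d zA; apply: falling2D_pred.
  by lia.
- have -> : A == set0 = false by apply/negbTE/set0Pn; exists y.
  have : \sum_(z in R) d z + #|A| = \sum_(z in R) (d1 z + d2 z).
    rewrite -(sum_ind sAR) -big_split /=; apply: eq_bigr => z zR; rewrite /d.
    by case zA: (z \in A); rewrite ?subn0 ?addn0 // subnK //; have [] := AP z zA; lia.
  by lia.
Qed.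

(* Merge the two cliques, drop one edge at each neighbour of [K1] and let [y] play
   the role of the lost vertex of [K1]; the edge [z1 y] comes for free. *)
Lemma adjacent_max y z1 : ee g K1 K2 = 0 -> y \in R -> d1 y = 0 ->
  {in R, forall u, d1 u <= (d2 y).+1} -> z1 \in R -> 0 < d1 z1 -> g z1 y -> False.
Proof.
move=> e0 yR y1 ymax z1R z1p gz1y.
have [gs gi] := gg; have [g0s g0i] := g0_graph.
pose S1 := [set z in R | 0 < d1 z].
(* Members of [B] get a new edge to [y]; members of [A] have one already and are left to [layer]. Of
   the [#|S1|] edges saved, [#|B|] are spent and [#|A|] remain, as [att_gain] requires. *)
pose B := S1 :\: nb g y; pose A := S1 :&: nb g y.
pose h := addf g0 B (fun=> y).
pose d z := (d1 z).-1 + d2 z.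
have S1P z : z \in S1 -> 0 < d1 z by rewrite inE => /andP[].
have nS1P z : z \in R -> z \notin S1 -> d1 z = 0.
  by move=> zR; rewrite inE zR /= -eqn0Ngt => /eqP.
have sS1 : S1 \subset R by apply/subsetP=> z; rewrite inE => /andP[].
have sAS : A \subset S1 := subsetIl _ _.
have sBS : B \subset S1 := subsetDl _ _.
have sAR : A \subset R := subset_trans sAS sS1.
have yS1 : y \notin S1 by apply/negP => /S1P; rewrite y1.
have yB : {in B, forall a, y != a}.
  by move=> a aB; apply: contraNneq yS1 => ->; apply: (subsetP sBS).
have gh : graph h by apply: addf_graph => //; apply: g0_graph.
have sgh : subrel g0 h := @addf_sub _ g0 B (fun=> y).
have g0R z u : u \in nb g0 z -> u \in R by rewrite inE => /and3P[].
have phi z u : z \in R -> u \in R -> minn (d1 z) (d1 u) + minn (d2 z) (d2 u) <=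
    minn (d z) (d u) + ((z \in S1) && (u \in S1)).
  by move=> zR uR; rewrite [z \in S1]inE [u \in S1]inE zR uR /=; apply: minn_pred.
apply: (@att_gain h d A gh) => //.
- apply: addf_supp; first exact: outer_supp.
  by move=> a aB; split=> //; apply: (subsetP sS1); apply: (subsetP sBS).
- by move=> u /d_sum; apply: leq_trans; rewrite leq_add2r leq_pred.
- move=> z zR zA; apply: leq_trans (orig_sat zR) _; rewrite ee_cross0 // /tau.
  have [zB|zB] := boolP (z \in B).
    have zS := subsetP sBS z zB.
    have nyz : y \notin nb g0 z.
      by move: zB; rewrite !inE => /andP[/negPf nyz _]; rewrite /g0 /outer gs nyz.
    (* In [h] all of [S1] is adjacent to [y], so the edge from [z] to [y] closes a triangle with
       every neighbour of [z] in [S1]. *)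
    have w1 : wt g0 z + 2 * #|nb g0 z :&: S1| <= wt h z.
      apply: (@wt_gain _ _ _ _ y) => //.
      - exact: (@addf_l _ g0 B (fun=> y)).
      - apply/subsetP => c; rewrite in_setI => /andP[czg cS1]; rewrite !inE in czg *.
        rewrite sgh //=; have [cB|] := boolP (c \in B); first exact: (@addf_r _ g0 B (fun=> y)).
        rewrite inE cS1 andbT negbK inE => gyc; apply: sgh.
        by rewrite /g0 /outer gyc yR (subsetP sS1 _ cS1).
      - by move=> c _; move: nyz; rewrite inE => /negPf->.
    (* The new neighbour [y] adds a summand, which pays for the dropped edge when [d2 z = 0]. *)
    have w2 : \sum_(u in nb g0 z) minn (d z) (d u) + minn (d z) (d y) <= \sum_(u in nb h z) minn (d z) (d u).
      rewrite [in X in _ <= X](bigD1 y) /=; last by rewrite inE; apply: (@addf_l _ g0 B (fun=> y)).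
      rewrite addnC leq_add2l [X in X <= _]big_mkcond [X in _ <= X]big_mkcond /=.
      apply: leq_sum => u _; case: ifP => // ug; have uy : u != y by apply: contraNneq nyz => <-.
      by rewrite ifT // uy andbT; apply: (subsetP (sub_nb z sgh)).
    have w3 : \sum_(u in nb g0 z) (minn (d1 z) (d1 u) + minn (d2 z) (d2 u)) <=
      \sum_(u in nb g0 z) minn (d z) (d u) + #|nb g0 z :&: S1|.
      rewrite -sum_indI -big_split /=.
      by apply: leq_sum => u /g0R uR; have := phi z u zR uR; rewrite zS.
    have := @falling2_pred (d1 z) (d2 z) (d2 y) (S1P _ zS) (ymax z zR).
    rewrite -/(d z); have : minn (d z) (d y) >= (if d2 z == 0 then minn (d1 z).-1 (d2 y) else 0).
      by rewrite /d y1; case: ifP => // /eqP->; rewrite addn0.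
    by move: w1 w2 w3; clear; lia.
  have zS : z \notin S1.
    by move: zA zB; rewrite in_setI in_setD; case: (z \in S1); case: (z \in nb g y).
  have z0 := nS1P z zR zS.
  have w1 : wt g0 z <= wt h z := wt_sub _ sgh.
  have w2 : \sum_(u in nb g0 z) minn (d z) (d u) <= \sum_(u in nb h z) minn (d z) (d u).
    rewrite [X in X <= _]big_mkcond [X in _ <= X]big_mkcond /=.
    by apply: leq_sum => u _; case: ifP => // ug; rewrite ifT //; apply: (subsetP (sub_nb z sgh)).
  have w3 : \sum_(u in nb g0 z) (minn (d1 z) (d1 u) + minn (d2 z) (d2 u)) <=
    \sum_(u in nb g0 z) minn (d z) (d u).
    by apply: leq_sum => u /g0R uR; have := phi z u zR uR; rewrite (negPf zS) addn0.
  have q : d z * (d z).-1 = d2 z * (d2 z).-1 by rewrite /d z0.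
  have -> : d1 z * (d1 z).-1 = 0 by rewrite z0.
  by rewrite q; move: w1 w2 w3; clear; lia.
- move=> z zA; have zS := subsetP sAS z zA; have zR := subsetP sS1 z zS; split; last first.
    have := outer_deg K12 g zR; rewrite -/d1 -/d2 -/g0 /d.
    have : t < #|nb g z| by apply: (nbr_high gc1) (S1P _ zS); move: zR; rewrite !inE => /norP[].
    have := subset_leq_card (sub_nb z sgh).
    by have := S1P _ zS; clear; lia.
  apply: leq_trans (orig_sat zR) _; rewrite ee_cross0 // /tau.
  have yz : g0 z y by move: zA; rewrite !inE /g0 /outer zR yR gs => /andP[_ ->].
  have w1 : wt g0 z + 2 * #|nb g0 z :&: B| <= wt h z.
    apply: (@wt_gain _ _ _ _ y) => //.
    - exact: sgh.
    - apply/subsetP => c; rewrite in_setI => /andP[czg cB]; rewrite !inE in czg *.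
      by rewrite sgh //=; apply: (@addf_r _ g0 B (fun=> y)).
    - move=> c; rewrite in_setI => /andP[_]; rewrite in_setD inE => /andP[/negPf nyc _].
      by rewrite /g0 /outer nyc !andbF.
  have w2 : \sum_(u in nb g0 z) minn (d z) (d u) <= \sum_(u in nb h z) minn (d z) (d u).
    rewrite [X in X <= _]big_mkcond [X in _ <= X]big_mkcond /=.
    by apply: leq_sum => u _; case: ifP => // ug; rewrite ifT //; apply: (subsetP (sub_nb z sgh)).
  (* Here [y] is an old neighbour of [z]; its summand grows under the merger, by enough to pay when
     [d2 z = 0]. *)
  have w3 : \sum_(u in nb g0 z) (minn (d1 z) (d1 u) + minn (d2 z) (d2 u))
      + (if d2 z == 0 then minn (d1 z).-1 (d2 y) else 0) <=
    \sum_(u in nb g0 z) minn (d z) (d u) + #|nb g0 z :&: S1|.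
    rewrite -sum_indI -big_split /= (bigD1 y) ?inE //= [X in _ <= X](bigD1 y) ?inE //=.
    rewrite addnAC; apply: leq_add.
      by rewrite /d y1; apply: leq_trans (leq_addr _ _); apply: minn_shift.
    by apply: leq_sum => u /andP[/g0R uR _]; have := phi z u zR uR; rewrite zS.
  have w4 : #|nb g0 z :&: S1| <= #|nb g0 z :&: B| + #|nb h z :&: A|.
    apply: leq_trans (_ : #|(nb g0 z :&: B) :|: (nb h z :&: A)| <= _); last exact: (leq_card_setU _ _).1.
    apply/subset_leq_card/subsetP => c; rewrite !inE => /andP[hzc /andP[cR cd]].
    by rewrite cR cd hzc (sgh _ _ hzc) /= andbT; case: (g y c).
  have := @falling2_pred (d1 z) (d2 z) (d2 y) (S1P _ zS) (ymax z zR).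
  by rewrite -/(d z); move: w1 w2 w3 w4; clear; lia.
- have -> : A == set0 = false.
    by apply/negbTE/set0Pn; exists z1; rewrite !inE gs gz1y z1p; move: z1R; rewrite !inE => ->.
  have := addf_vol g0 B (fun=> y); rewrite -/h.
  have : #|S1| = #|B| + #|A| by rewrite -(cardsID (nb g y) S1) addnC.
  have : \sum_(z in R) d z + #|S1| = \sum_(z in R) (d1 z + d2 z).
    rewrite -(sum_ind sS1) -big_split /=; apply: eq_bigr => z zR; rewrite /d.
    by have [/S1P|/(nS1P _ zR)->] := boolP (z \in S1) => //; clear; lia.
  by clear; lia.
Qed.

End Pair.

(** * Exchanges at a single good clique *)

Section Single.
Variable K : {set X}.
Hypothesis gK : gc K.
Let d := dg g K.
Let g0 := outer K set0 g.

Lemma gain1 h e A : graph h -> (forall u v, h u v -> u \in ~: K /\ v \in ~: K) ->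
  {in ~: K, forall u, e u <= t.+1} -> A \subset ~: K ->
  {in ~: K, forall z, z \notin A -> t * t.-1 <= tau h e z} ->
  {in A, forall a, t * t.-1 <= tau h e a + 2 * #|nb h a :&: A| /\ t <= #|nb h a| + e a} ->
  vol h + 2 * \sum_(z in ~: K) e z + 2 * #|A| + (A == set0)
   <= vol g0 + 2 * \sum_(z in ~: K) d z -> False.
Proof.
move=> gh sh et sA nA wA vh.
have K0 : [disjoint K & set0] by rewrite -setI_eq0 setI0.
apply: (@att_gain K set0 K0 gK (or_introl erefl) h e A); rewrite ?setU0 //.
  by rewrite /supp setU0.
apply: leq_trans vh _; rewrite -/g0; apply: leq_trans (leq_addr _ _).
by rewrite leq_add2l leq_mul2l /=; apply: leq_sum => z _; apply: leq_addr.
Qed.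

Lemma sat1 z : z \in ~: K -> t * t.-1 <= wt g0 z
    + 2 * \sum_(u in nb g0 z) minn (d z) (d u) + d z * (d z).-1.
Proof.
move=> zK; have K0 : [disjoint K & set0] by rewrite -setI_eq0 setI0.
have zK' : z \in ~: (K :|: set0) by rewrite setU0.
have d0 u : dg g set0 u = 0 by rewrite /dg setI0 cards0.
apply: leq_trans (gW z) _; apply: leq_trans (outer_wt K0 gg zK') _.
have e0 : ee g (nb g z :&: K) set0 = 0.
  by rewrite eeC ?/ee ?big_set0 //; exact: graph_sym gg.
rewrite d0 setI0 e0 muln0 !addn0.
rewrite leq_add2r leq_add2l leq_mul2l /=; apply: leq_sum => u _.
by rewrite d0 minn0 addn0.
Qed.

Lemma g01P u v : g0 u v = [&& g u v, u \in ~: K & v \in ~: K].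
Proof. by rewrite /g0 /outer setU0. Qed.

Lemma g01_graph : graph g0. Proof. exact: outer_graph. Qed.

Lemma d1_le z : z \in ~: K -> 16 * d z <= t.
Proof.
rewrite inE => zK; have [_ _ s] := gK; apply: leq_trans s.
by rewrite leq_mul2l dg_le.
Qed.

(** Otherwise detach [K] completely. Each neighbour [z] of [K] loses one edge and at most one
    triangle per neighbour in [A], which is what [layer] restores; [A] is nonempty because [K] is
    not a component. *)
Lemma some_double : exists2 u, u \in ~: K & 1 < d u.
Proof.
have [/existsP[u /andP[]]|no] := boolP [exists u, (u \in ~: K) && (1 < d u)]; first by exists u.
have dle u : u \in ~: K -> d u <= 1.
  by move=> uK; rewrite leqNgt; apply: contra no => du; apply/existsP; exists u; rewrite uK.
pose A := [set z in ~: K | 0 < d z].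
have sA : A \subset ~: K by apply/subsetP=> z; rewrite inE => /andP[].
have dA z : z \in ~: K -> d z = (z \in A).
  by move=> zK; rewrite inE zK /=; have := dle z zK; case: (d z) => [|[]].
exfalso; apply: (@gain1 g0 (fun=> 0) A g01_graph) => //.
- by move=> u v; rewrite g01P => /and3P[].
- move=> z zK zA; apply: leq_trans (sat1 zK) _; rewrite /tau (dA _ zK) (negPf zA).
  apply: leq_trans (_ : wt g0 z <= _); last by rewrite -addnA leq_addr.
  by rewrite big1 ?muln0 ?addn0 // => u _; rewrite min0n.
- move=> z zA; have zK := subsetP sA z zA; have dz := dA z zK; rewrite zA in dz; split.
    apply: leq_trans (sat1 zK) _; rewrite dz /tau -sum_indI !muln0 !addn0 -addnA leq_add2l.
    apply: leq_trans (leq_addl _ _); rewrite leq_mul2l /=; apply: leq_sum => u.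
    by rewrite inE g01P => /and3P[_ _ uK]; rewrite (dA _ uK) geq_minr.
  have K0 : [disjoint K & set0] by rewrite -setI_eq0 setI0.
  have zK' : z \in ~: (K :|: set0) by rewrite setU0.
  have := outer_deg K0 g zK'; rewrite -/g0 -/d dz /dg setI0 cards0.
  have : t < #|nb g z| by apply: (nbr_high gK); rewrite -/d ?dz //; move: zK; rewrite inE.
  by clear; lia.
have -> : A == set0 = false.
  apply/negbTE/negP => /eqP A0; have := excl_gt0 gK; rewrite /excl big1 // => z zK.
  by rewrite -/d dA // A0 inE.
rewrite (eq_bigr _ dA) sum_ind // big1 //; lia.
Qed.

(* Otherwise truncate [d] at its maximum minus 2, and repair every [z] that loses
   by a single edge to a non-neighbour with many common neighbours. *)
Lemma unfixable : exists z, [/\ z \notin K, 0 < d z, {in ~: K, forall u, d u <= (d z).+1},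
    forall v, g z v -> t < #|nb g v| &
    forall y, y \notin K -> y != z -> ~~ g z y -> 8 * #|(nb g z :&: nb g y) :\: K| < t].
Proof.
have [u1 u1K u1d] := some_double; have [gs gi] := gg.
pose u0 := [arg max_(u > u1 in ~: K) d u].
have [u0K u0m] : u0 \in ~: K /\ {in ~: K, forall u, d u <= d u0}.
  by rewrite /u0; case: arg_maxnP => // u uK um; split=> // v vK; apply: um.
have [m em] : exists m, d u0 = m by eexists.
rewrite em in u0m; have m1 : 1 < m := leq_trans u1d (u0m _ u1K).
(* Only the vertices of [Q], where [d] is [m - 1] or [m], lose under truncation at [m - 2]. *)
pose Q := [set z in ~: K | m <= (d z).+1].
pose fx z y := [&& y \in ~: K, y != z, ~~ g z y & t <= 8 * #|(nb g z :&: nb g y) :\: K|].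
pose low z := [exists v, g z v && (#|nb g v| == t)].
have [/existsP[z /and3P[zQ nlow nfx]]|no] :=
  boolP [exists z, [&& z \in Q, ~~ low z & ~~ [exists y, fx z y]]].
  move: zQ; rewrite inE => /andP[zK mz]; exists z; split.
  - by move: zK; rewrite inE.
  - by rewrite -ltnS (leq_trans m1).
  - by move=> u uK; apply: leq_trans (u0m u uK) mz.
  - move=> v gzv; rewrite ltn_neqAle deg_ge andbT eq_sym; apply: contra nlow => e.
    by apply/existsP; exists v; rewrite gzv.
  - move=> y yK yz gzy; rewrite ltnNge; apply: contra nfx => c; apply/existsP; exists y.
    by rewrite /fx inE yK yz gzy.
exfalso.
have fixQ z : z \in Q -> low z \/ exists y, fx z y.
  move=> zQ; have [|nl] := boolP (low z); first by left.
  by right; apply/existsP; apply: contraNT no => nf; apply/existsP; exists z; rewrite zQ nl.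
pose f z := odflt z [pick y | fx z y].
pose B := [set z in Q | [exists y, fx z y]].
have fB z : z \in B -> fx z (f z).
  by rewrite inE => /andP[_ /existsP[y fy]]; rewrite /f; case: pickP => //= /(_ y); rewrite fy.
have sQ : Q \subset ~: K by apply/subsetP=> z; rewrite inE => /andP[].
have sB : B \subset Q by apply/subsetP=> z; rewrite inE => /andP[].
pose h := addf g0 B f.
have gh : graph h by apply: addf_graph => [|a /fB/and4P[]//]; apply: g01_graph.
have sgh : subrel g0 h := @addf_sub _ g0 B f.
pose e z := minn (d z) (m - 2).
have sumge z : \sum_(u in nb g0 z) minn (e z) (e u) <= \sum_(u in nb h z) minn (e z) (e u).
  rewrite [X in X <= _]big_mkcond [X in _ <= X]big_mkcond /=.
  by apply: leq_sum => u _; case: ifP => // ug; rewrite ifT //; apply: (subsetP (sub_nb z sgh)).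
have g0K z u : u \in nb g0 z -> u \in ~: K by rewrite inE g01P => /and3P[].
apply: (@gain1 h e set0 gh).
- move=> u v /or3P[|/andP[uB /eqP<-]|/andP[vB /eqP<-]].
  + by rewrite g01P => /and3P[].
  + by split; [apply: (subsetP sQ); apply: (subsetP sB) | have /and4P[] := fB _ uB].
  + by split; [have /and4P[] := fB _ vB | apply: (subsetP sQ); apply: (subsetP sB)].
- by move=> u uK; rewrite /e; have := d1_le uK; clear; lia.
- exact: sub0set.
- move=> z zK _; have [zQ|zQ] := boolP (z \in Q); last first.
    apply: leq_trans (sat1 zK) _; rewrite /tau.
    have zm : (d z).+1 < m by move: zQ; rewrite inE zK /= ltnNge.
    have ez : e z = d z by rewrite /e; move: zm; clear; lia.
    have w1 : wt g0 z <= wt h z := wt_sub _ sgh.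
    have w2 : \sum_(u in nb g0 z) minn (d z) (d u) <= \sum_(u in nb g0 z) minn (e z) (e u).
      by apply: leq_sum => u _; apply: minn_low.
    by move: w1 w2 (sumge z); rewrite ez; clear; lia.
  have [zl|[y fy]] := fixQ z zQ.
    (* The closed neighbourhood of a degree-[t] neighbour [v] of [z] is a clique disjoint from [K];
       it survives in [g0] and alone gives [z] enough triangles. *)
    move/existsP: zl => [v /andP[gzv /eqP ev]]; rewrite /tau -addnA; apply: leq_trans (leq_addr _ _).
    apply: leq_trans (_ : wt g0 z <= _); last exact: wt_sub.
    have [cv cardv] := low_cliq ev.
    have vK : v \notin K.
      apply/negP => vK; have [eK cK _] := gK.
      have /eqP eKv : K == v |: nb g v.
        rewrite eqEcard cardv eK leqnn andbT; apply/subsetP => u uK; rewrite !inE.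
        by have [//|uv] := eqVneq u v; rewrite cK // eq_sym.
      by move: zK; rewrite inE eKv !inE gs gzv orbT.
    apply: (cliq_sat (S := v |: nb g v)); rewrite ?inE 1?gs ?gzv ?orbT //.
    have nK a : a \in v |: nb g v -> a \in ~: K.
      rewrite !inE => /orP[/eqP->//|gva]; apply/negP => aK.
      by have := nbr_high gK vK (dg_gt0 aK gva); rewrite ev ltnn.
    by move=> a b aS bS ab; rewrite g01P (nK a) // (nK b) // cv.
  have zB : z \in B by rewrite inE zQ; apply/existsP; exists y.
  have /and4P[fK fz nfz fc] := fB z zB.
  apply: leq_trans (sat1 zK) _; rewrite /tau.
  have w1 : wt g0 z + 2 * #|nb g0 z :&: nb g0 (f z)| <= wt h z.
    apply: (@wt_gain _ _ _ _ (f z)) => //.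
    - exact: g01_graph.
    - exact: addf_l.
    - by apply: setISS; apply: sub_nb.
    - by move=> c _; rewrite g01P (negPf nfz).
  have w2 : #|(nb g z :&: nb g (f z)) :\: K| <= #|nb g0 z :&: nb g0 (f z)|.
    apply/subset_leq_card/subsetP => c; rewrite in_setD in_setI !inE !g01P => /and3P[cK -> ->].
    by rewrite zK fK inE cK.
  have mz : m <= (d z).+1 by move: zQ; rewrite inE => /andP[].
  have w3 : \sum_(u in nb g0 z) minn (d z) (d u) <= \sum_(u in nb g0 z) minn (e z) (e u) + 2 * #|Q|.-1.
    apply: leq_trans (_ : \sum_(u in nb g0 z) minn (e z) (e u) + 2 * #|nb g0 z :&: Q| <= _).
      rewrite -sum_indI big_distrr -big_split /=; apply: leq_sum => u /g0K uK.
      rewrite [u \in Q]inE uK; apply: minn_trunc => //; exact: u0m.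
    rewrite leq_add2l leq_mul2l /= (cardsD1 z Q) zQ /=; apply/subset_leq_card/subsetP => u.
    rewrite in_setI in_setD1 => /andP[gu ->]; rewrite andbT; apply: contraTneq gu => ->.
    by rewrite inE (graph_irr g01_graph).
  have w4 : m + #|Q|.-1 <= excl K.
    (* The maximiser [u0] accounts for [m] edges leaving [K], every other member of [Q] for at least
       one. *)
    have u0Q : u0 \in Q by rewrite inE u0K em ltnW.
    rewrite /excl (bigD1 u0) //= -/d em leq_add2l (cardsD1 u0 Q) u0Q /= -sum1_card.
    rewrite [X in X <= _]big_mkcond [X in _ <= X]big_mkcond /=; apply: leq_sum => u _.
    rewrite !inE; case: (u == u0) => //=; case uK: (u \in K) => //=; rewrite ?andbF //.
    by case: ifP => // mu; rewrite -ltnS (leq_trans m1).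
  have w5 : 2 * excl K <= #|nb g0 z :&: nb g0 (f z)|.
    have [_ _ s] := gK; move: s fc w2; clear; lia.
  have := falling2_trunc m1 mz (u0m z zK) (erefl (e z)) w3 w4 w5.
  by move: w1 (sumge z); clear; lia.
- by move=> a; rewrite inE.
rewrite cards0 eqxx.
have v1 := addf_vol g0 B f; rewrite -/h in v1.
have v2 := subset_leq_card sB.
(* Truncation saves two edges at [u0] and at least one at every other member of [Q]. This exceeds
   the number of new edges, at most [#|Q|], and so gives the strict saving needed for an empty
   exceptional set. *)
have v3 : \sum_(z in ~: K) e z + #|Q| + 1 <= \sum_(z in ~: K) d z.
  have -> : 1 = \sum_(z in ~: K) (z \in [set u0]) by rewrite sum_ind ?cards1 ?sub1set.
  rewrite -(sum_ind sQ) -!big_split /=; apply: leq_sum => z zK; rewrite /e !inE.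
  rewrite inE in zK; rewrite zK /=.
  have [->|_] := eqVneq z u0; first by rewrite em; move: m1; clear; lia.
  by move: m1; clear; lia.
by move: v1 v2 v3; clear; lia.
Qed.

End Single.

(** * Separation of the vertices chosen for different good cliques *)

Lemma no_cross_in K1 K2 z : gc K1 -> gc K2 -> K1 != K2 -> 0 < dg g K1 z -> z \notin K2.
Proof.
move=> g1 g2 n12 dz; apply/negP => zK.
have gs := graph_sym gg.
have := no_cross (gc_disj g1 g2 n12) g1 (or_intror g2); rewrite eeC //.
by move/eqP; rewrite /ee (bigD1 z) //= addn_eq0 setIC -/(dg g K1 z) => /andP[/eqP e _]; rewrite e in dz.
Qed.

Lemma pair_le K1 K2 z1 z2 M : gc K1 -> gc K2 -> K1 != K2 ->
  z1 \notin K1 -> 0 < dg g K1 z1 -> z2 \notin K2 -> 0 < dg g K2 z2 ->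
  {in ~: K1, forall u, dg g K1 u <= M} -> {in ~: K2, forall u, dg g K2 u <= M} ->
  M <= (dg g K2 z2).+1 -> z1 != z2 /\ ~~ g z1 z2.
Proof.
move=> g1 g2 n12 z1K d1z z2K d2z M1 M2 Mz.
have D12 := gc_disj g1 g2 n12; have e0 := no_cross D12 g1 (or_intror g2).
have z1R : z1 \in ~: (K1 :|: K2) by rewrite !inE negb_or z1K (no_cross_in g1 g2).
have z2R : z2 \in ~: (K1 :|: K2) by rewrite !inE negb_or z2K (no_cross_in g2 g1) // eq_sym.
have inR u : u \in ~: (K1 :|: K2) -> u \in ~: K1 /\ u \in ~: K2.
  by rewrite !inE => /norP.
have z0 : dg g K1 z2 = 0.
  apply/eqP; rewrite -leqn0 leqNgt; apply/negP => d1z2.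
  pose y := [arg max_(u > z2 in ~: (K1 :|: K2)) (dg g K1 u + dg g K2 u)].
  have [yR ymax] : y \in ~: (K1 :|: K2) /\ {in ~: (K1 :|: K2), forall u,
      dg g K1 u + dg g K2 u <= dg g K1 y + dg g K2 y}.
    by rewrite /y; case: arg_maxnP => // u uR um; split=> // v vR; apply: um.
  have [y1K y2K] := inR y yR.
  (* If the degree sums never exceed [M], then [z2] attains their maximum. Otherwise the maximiser
     [y] has neighbours in both cliques, since neither degree alone exceeds [M]. In both cases
     [overlap_max] applies. *)
  have [yM|yM] := leqP (dg g K1 y + dg g K2 y) M.
    apply: (overlap_max D12 g1 (or_intror g2) (y := z2)) => // u uR.
    by move: (ymax u uR) yM Mz d1z2; clear; lia.
  apply: (overlap_max D12 g1 (or_intror g2) (y := y)) => //.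
    by move: (M2 y y2K) yM; clear; lia.
  by move: (M1 y y1K) yM; clear; lia.
split; first by apply: contraTneq d1z => ->; rewrite z0.
apply/negP => gz; apply: (adjacent_max D12 g1 (or_intror g2) (y := z2) (z1 := z1)) => //.
by move=> u /inR[uK _]; apply: leq_trans (M1 u uK) Mz.
Qed.

(** [pair_le] is applied with the larger of the two maximal degrees as [M], the clique attaining it
    taking the place of [K2]. *)
Lemma pair K1 K2 z1 z2 : gc K1 -> gc K2 -> K1 != K2 ->
  z1 \notin K1 -> 0 < dg g K1 z1 -> z2 \notin K2 -> 0 < dg g K2 z2 ->
  {in ~: K1, forall u, dg g K1 u <= (dg g K1 z1).+1} ->
  {in ~: K2, forall u, dg g K2 u <= (dg g K2 z2).+1} -> z1 != z2 /\ ~~ g z1 z2.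
Proof.
move=> g1 g2 n12 z1K d1z z2K d2z M1 M2.
pose N1 := \max_(u in ~: K1) dg g K1 u; pose N2 := \max_(u in ~: K2) dg g K2 u.
have b1 : {in ~: K1, forall u, dg g K1 u <= N1} by move=> u uK; apply: leq_bigmax_cond.
have b2 : {in ~: K2, forall u, dg g K2 u <= N2} by move=> u uK; apply: leq_bigmax_cond.
have s1 : N1 <= (dg g K1 z1).+1 by apply/bigmax_leqP.
have s2 : N2 <= (dg g K2 z2).+1 by apply/bigmax_leqP.
have [le|lt] := leqP N1 N2.
  by apply: (@pair_le K1 K2 z1 z2 N2) => // u uK; apply: leq_trans (b1 u uK) le.
rewrite eq_sym (graph_sym gg); apply: (@pair_le K2 K1 z2 z1 N1) => //; first by rewrite eq_sym.
by move=> u uK; apply: leq_trans (b2 u uK) (ltnW lt).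
Qed.

(** * Counting vertices by total excess *)

Definition exc v := #|nb g v| - t.

Lemma degE v : #|nb g v| = t + exc v.
Proof. by rewrite /exc subnKC ?deg_ge. Qed.

Lemma excl_exc K : #|K| = t.+1 -> cliq g K -> excl K = \sum_(w in K) exc w.
Proof.
move=> eK cK; have gs := graph_sym gg.
have -> : excl K = ee g (~: K) K by apply: eq_bigr => z _; rewrite /dg setIC.
rewrite eeC //; apply: eq_bigr => w wK; rewrite /exc -(cardsID K (nb g w)).
have -> : #|nb g w :&: K| = t.
  have <- : #|K :\ w| = t by apply/eqP; rewrite -eqSS -eK (cardsD1 w K) wK.
  congr #|pred_of_set _|; apply/setP=> u; rewrite !inE.
  have [->|uw] := eqVneq u w; first by rewrite (graph_irr gg).
  by case uK: (u \in K); rewrite ?andbF // cK // eq_sym.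
by rewrite addKn setIC setDE.
Qed.

Let low v := #|nb g v| == t.
Let nbc v := v |: nb g v.

(** Let each [w] send [minn t (16 * exc w)] to every neighbour. A vertex of the set receives at
    least [t], while [w] sends at most [17 * exc w * t] in all, by the two cases of the minimum. *)
Lemma card_bad : #|[set v | low v & t < 16 * excl (nbc v)]| <= 17 * \sum_v exc v.
Proof.
set B := [set v | _ & _]; have gs := graph_sym gg.
have key v : v \in B -> t <= \sum_(w in nb g v) minn t (16 * exc w).
  rewrite inE => /andP[/eqP lv tv]; have [cv ev] := low_cliq lv.
  have [/existsP[w /andP[wv tw]]|no] := boolP [exists w, (w \in nb g v) && (t <= 16 * exc w)].
    by rewrite (bigD1 w) //= (minn_idPl tw) leq_addr.
  rewrite (eq_bigr (fun w => 16 * exc w)); last first.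
    move=> w wv; apply/minn_idPr; rewrite leqNgt; apply: contra no => /ltnW tw.
    by apply/existsP; exists w; rewrite wv.
  rewrite -big_distrr /=; move: tv; rewrite (excl_exc ev cv) big_setU1 /=; last first.
    by rewrite inE (graph_irr gg).
  by rewrite {1}/exc lv subnn add0n => /ltnW.
have h1 : #|B| * t <= \sum_v \sum_(w in nb g v) minn t (16 * exc w).
  rewrite -sum_nat_const [X in _ <= X](bigID (fun v => v \in B)) /=.
  by apply: leq_trans (leq_addr _ _); apply: leq_sum.
have h2 : \sum_v \sum_(w in nb g v) minn t (16 * exc w) <= \sum_w 17 * exc w * t.
  rewrite (exchange_big_dep xpredT) //=; apply: leq_sum => w _.
  rewrite (eq_bigl (fun v => v \in nb g w)); last by move=> v; rewrite !inE gs.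
  rewrite sum_nat_const degE; move: (exc w) => e; have [le|lt] := leqP t (16 * e).
    have h : t * t <= t * (16 * e) by rewrite leq_mul2l le orbT.
    by move: h; clear; lia.
  have h : e * (16 * e) <= e * t by rewrite leq_mul2l (ltnW lt) orbT.
  by move: h; clear; lia.
have h3 : #|B| * t <= 17 * (\sum_v exc v) * t.
  by apply: leq_trans h1 _; apply: leq_trans h2 _; rewrite big_distrr /= big_distrl.
by rewrite leq_pmul2r in h3 => //; apply: ltnW.
Qed.

Let KK := [set nbc v | v in [set v | low v & 16 * excl (nbc v) <= t]].

Lemma KK_gc K : K \in KK -> gc K.
Proof.
case/imsetP=> v; rewrite inE => /andP[/eqP lv s] ->; have [cv ev] := low_cliq lv.
by split.
Qed.

Lemma card_split : #|X| <= 18 * \sum_v exc v + #|KK| * t.+1.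
Proof.
pose H := [set v | t < #|nb g v|].
pose B := [set v | low v & t < 16 * excl (nbc v)].
pose G := [set v | low v & 16 * excl (nbc v) <= t].
have hH : #|H| <= \sum_v exc v.
  rewrite -sum1_card big_mkcond; apply: leq_sum => v _; rewrite inE.
  by case: ifP => //; rewrite degE; clear; lia.
have hG : #|G| <= #|KK| * t.+1.
  rewrite -sum_nat_const; apply: leq_trans (_ : #|cover KK| <= _).
    apply/subset_leq_card/subsetP => v vG; apply/bigcupP; exists (nbc v).
      exact: imset_f.
    by rewrite !inE eqxx.
  apply: leq_trans (leq_card_cover _) _; apply: leq_sum => K /KK_gc[-> _ _].
  exact: leqnn.
have hB := card_bad; rewrite -/B in hB.
have : #|X| <= #|H :|: (B :|: G)|.
  rewrite -cardsT; apply/subset_leq_card/subsetP => v _; rewrite !inE /low.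
  have := deg_ge v; rewrite leq_eqVlt eq_sym; case: eqP => /= [_ _|_ -> //].
  by rewrite [t < 16 * _]ltnNge orNb orbT.
have := (leq_card_setU H (B :|: G)).1; have := (leq_card_setU B G).1.
by move: hH hG hB; clear; lia.
Qed.

(** Discharging: a good clique [K] collects [5 * exc (z K)] from [z K] and 1 from each vertex dense
    in [P K]. It obtains at least [5 * t / 6], and no vertex [x] pays more than [5 * exc x]. *)
Lemma card_KK (x0 : X) : 23 < t -> #|KK| * t <= 6 * \sum_v exc v.
Proof.
move=> t24; have gs := graph_sym gg.
have /fin_all_exists[z zP] : forall K, exists z, K \in KK -> 
   [/\ z \notin K, 0 < dg g K z, {in ~: K, forall u, dg g K u <= (dg g K z).+1},
    forall v, g z v -> t < #|nb g v| &
    forall y, y \notin K -> y != z -> ~~ g z y -> 8 * #|(nb g z :&: nb g y) :\: K| < t].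
  move=> K; have [KK_K|nK] := boolP (K \in KK); last by exists x0.
  by have [z] := unfixable (KK_gc KK_K); exists z.
pose P K := nb g (z K) :\: K.
have zpair K L : K \in KK -> L \in KK -> K != L -> z K != z L /\ ~~ g (z K) (z L).
  move=> KK_K KK_L nKL; have [a1 a2 a3 _ _] := zP K KK_K; have [b1 b2 b3 _ _] := zP L KK_L.
  exact: (pair (KK_gc KK_K) (KK_gc KK_L)).
have PI K L : K \in KK -> L \in KK -> K != L -> 8 * #|P K :&: P L| < t.
  move=> KK_K KK_L nKL; have [zK nzKL] := zpair K L KK_K KK_L nKL.
  have [_ _ _ _ uf] := zP K KK_K; have [_ b2 _ _ _] := zP L KK_L.
  apply: leq_ltn_trans (uf (z L) _ _ nzKL); last by rewrite eq_sym.
    rewrite leq_mul2l /=; apply/subset_leq_card/subsetP => c; rewrite !inE.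
    by case/andP=> /andP[-> ->] /andP[_ ->].
  by apply: (no_cross_in (KK_gc KK_L)) b2; rewrite 1?eq_sym //; apply: KK_gc.
(* The threshold [11 / 16] is half of [1 + 1 / 4 + 1 / 8]: a vertex of excess below [t / 4] cannot
   be dense for two sets that share fewer than [t / 8] vertices. *)
pose dense K x := (x \in P K) && (11 * t <= 16 * #|nb g x :&: P K|).
pose own x := [set K in KK | dense K x].
have own_le x : #|own x| <= 5 * exc x.
  have [heavy|light] := leqP t (4 * exc x).
    (* The vertices [z K] with [K] in [own x] are distinct neighbours of [x], and
       [t + exc x <= 5 * exc x]. *)
    apply: leq_trans (_ : #|nb g x| <= _); last by rewrite degE; move: heavy; clear; lia.
    rewrite -(card_in_imset (f := z)).
      apply/subset_leq_card/subsetP => v /imsetP[K]; rewrite !inE => /andP[_ /andP[xP _]] ->.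
      by move: xP; rewrite !inE gs => /andP[].
    move=> K L; rewrite !inE => /andP[KK_K _] /andP[KK_L _] e; apply/eqP/negPn/negP => nKL.
    by have [] := zpair K L KK_K KK_L nKL; rewrite e eqxx.
  have [/eqP->|/set0Pn[K]] := boolP (own x == set0); first by rewrite cards0.
  move=> KO; have := KO; rewrite inE => /and3P[KK_K xP dK].
  have ex : 0 < exc x.
    have [_ _ _ hi _] := zP K KK_K; have := hi x; rewrite degE.
    by move: xP; rewrite !inE => /andP[_ gz] /(_ gz); clear; lia.
  have -> : own x = [set K]; last by rewrite cards1; move: ex; clear; lia.
  apply/setP=> L; rewrite in_set1; apply/idP/eqP => [LO|->//]; apply/eqP/negPn/negP => nLK.
  move: LO; rewrite inE => /and3P[KK_L _ dL].
  have i1 := PI L K KK_L KK_K nLK.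
  have i2 : #|nb g x :&: P L| + #|nb g x :&: P K| <= #|nb g x| + #|P L :&: P K|.
    rewrite -cardsUI; apply: leq_add; apply/subset_leq_card/subsetP => c; rewrite !inE.
      by case/orP => /andP[].
    by case/andP=> /andP[_ ->] /andP[_ ->].
  by move: i1 i2 dL dK light; rewrite degE; clear; lia.
pose D K := [set x | dense K x].
(* Few triangles at [z K] meet [K], so the degree sum inside [P K] must be large; vertices that are
   not dense contribute less than [11 * t / 16] each. *)
have main K : K \in KK -> 5 * t <= 6 * (#|D K| + 5 * exc (z K)).
  move=> KK_K; have gK := KK_gc KK_K; have [zK _ _ _ _] := zP K KK_K; have [_ _ sK] := gK.
  have zK' : z K \in ~: K by rewrite inE.
  pose u := #|P K :\: D K|.
  have DP : D K \subset P K by apply/subsetP=> x; rewrite inE => /andP[].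
  have eP : #|P K| = u + #|D K| by rewrite /u -(cardsID (D K) (P K)) (setIidPr DP) addnC.
  have nbP : nb (outer K set0 g) (z K) = P K.
    by apply/setP=> v; rewrite inE g01P !inE zK /= andbC.
  apply: (charge_ineq t24 eP).
    by rewrite -degE; apply/subset_leq_card/subsetDl.
  have := sat1 zK'; rewrite nbP wtE nbP => h.
  have h1 : \sum_(v in P K) minn (dg g K (z K)) (dg g K v) <= excl K.
    rewrite /excl [X in X <= _]big_mkcond [X in _ <= X]big_mkcond /=; apply: leq_sum => v _.
    by rewrite !inE; case: (v \in K) => //=; case: ifP => // _; apply: geq_minr.
  have h2 : 16 * \sum_(v in P K) #|P K :&: nb (outer K set0 g) v| <=
      u * (11 * t) + #|D K| * (16 * #|P K|).
    rewrite (big_setID (D K)) /= (setIidPr DP) addnC mulnDr /u -!sum_nat_const.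
    rewrite !big_distrr /=; apply: leq_add; apply: leq_sum => v; last first.
      by move=> _; rewrite leq_mul2l /= subset_leq_card // subsetIl.
    rewrite !inE /dense => /andP[nD vP]; move: nD; rewrite {1}/P !inE vP /= -ltnNge => nD.
    apply: leq_trans (ltnW nD); rewrite leq_mul2l /=; apply/subset_leq_card/subsetP => c.
    by rewrite !in_setI [c \in nb (outer _ _ _) _]inE [c \in nb g v]inE g01P => /andP[-> /andP[-> _]].
  have h3 : 16 * dg g K (z K) <= t by apply: d1_le.
  have h4 : 256 * (dg g K (z K) * (dg g K (z K)).-1) <= t * t.
    apply: leq_trans (_ : (16 * dg g K (z K)) * (16 * dg g K (z K)) <= _); last exact: leq_mul.
    rewrite mulnACA; apply: leq_mul => //; rewrite leq_mul2l leq_pred orbT //.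
  have h5 : t * t.-1 + t = t * t by case: (t) t24 => // s _ /=; clear; lia.
  move: h h1 h2 h4 h5 sK; clear.
  move: (\sum_(v in P K) #|_|) (\sum_(v in P K) minn _ _) (excl K) => S M e.
  move: (dg g K (z K) * _) (#|D K|) (#|P K|) (t * t.-1) => q w p tt.
  lia.
have sumD : \sum_(K in KK) #|D K| = \sum_x #|own x|.
  rewrite (eq_bigr (fun K => \sum_x (dense K x : nat))); last first.
    by move=> K _; rewrite -sum1_card big_mkcond; apply: eq_bigr => x _; rewrite inE; case: (dense K x).
  rewrite exchange_big /=; apply: eq_bigr => x _.
  by rewrite -sum1_card big_mkcond [RHS]big_mkcond; apply: eq_bigr => K _; rewrite inE; case: (K \in KK) => //; case: (dense K x).
have sumz : \sum_(K in KK) exc (z K) = \sum_(x in z @: KK) exc x.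
  rewrite [RHS]big_imset //= => K L KK_K KK_L e; apply/eqP/negPn/negP => nKL.
  by have [] := zpair K L KK_K KK_L nKL; rewrite e eqxx.
(* The vertices [z K] are pairwise non-adjacent, so none of them is also charged as a dense
   vertex. *)
have own0 x : x \in z @: KK -> #|own x| = 0.
  case/imsetP=> L KK_L ->; apply/eqP; rewrite cards_eq0; apply/eqP/setP=> K; rewrite inE in_set0.
  apply/negP => /and3P[KK_K xP _]; move: xP; rewrite !inE => /andP[_ gz].
  have [e|nKL] := eqVneq K L; first by rewrite e (graph_irr gg) in gz.
  by have [_] := zpair K L KK_K KK_L nKL; rewrite gz.
have tot : \sum_(K in KK) (#|D K| + 5 * exc (z K)) <= 5 * \sum_v exc v.
  rewrite big_split /= sumD -big_distrr /= sumz [5 * \sum_v _]big_distrr big_distrr /=.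
  rewrite [\sum_(x in z @: KK) _]big_mkcond -big_split /=; apply: leq_sum => x _.
  by case: ifP => [/own0->|_]; rewrite ?addn0.
have : \sum_(K in KK) 5 * t <= \sum_(K in KK) 6 * (#|D K| + 5 * exc (z K)).
  by apply: leq_sum.
rewrite sum_nat_const -big_distrr /=; move: tot; clear.
by move: (\sum_(K in KK) _) => S; lia.
Qed.

Lemma card_le_excess : 23 < t -> t * #|X| <= (24 * t + 6) * \sum_v exc v.
Proof.
move=> t24; have [->|/card_gt0P[x0 _]] := posnP #|X|; first by rewrite muln0.
have : t * #|X| <= t * (18 * \sum_v exc v + #|KK| * t.+1).
  by rewrite leq_mul2l card_split orbT.
have : #|KK| * t * t.+1 <= 6 * (\sum_v exc v) * t.+1 by rewrite leq_mul2r card_KK ?orbT.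
by clear; move: (\sum_v _) #|KK| => S k; lia.
Qed.

End Extremal.

(** * Two overlapping cliques *)

Section Construction.
Variables (X : finType) (t : nat).
Hypothesis tX : t < #|X|.
Let n := #|X|.
Let r := n %% t.+1.
Let rk (x : X) : nat := enum_rank x.

Lemma rk_lt x : rk x < n. Proof. exact: ltn_ord. Qed.

Lemma card_rk_lt b : #|[set x | rk x < b]| = minn b n.
Proof.
have -> : [set x | rk x < b] = [set enum_val i | i in [set i : 'I_n | i < b]].
  apply/setP=> x; rewrite inE; apply/idP/imsetP => [xb|[i]].
    by exists (enum_rank x); rewrite ?inE ?enum_rankK.
  by rewrite inE => ib ->; rewrite /rk enum_valK.
rewrite card_imset; last exact: enum_val_inj.
have -> : [set i : 'I_n | i < b] = [set widen_ord (geq_minr b n) i | i : 'I_(minn b n)].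
  apply/setP=> i; rewrite inE; apply/idP/imsetP => [ib|[j _ ->]].
    have im : i < minn b n by rewrite leq_min ib ltn_ord.
    by exists (Ordinal im) => //; apply: val_inj.
  by apply: leq_trans (ltn_ord j) (geq_minl _ _).
rewrite card_imset ?card_ord // => i j e; apply: val_inj.
by have /(congr1 val) := e.
Qed.

Let I a b := [set x | (a <= rk x) && (rk x < b)].

Lemma card_I a b : a <= b -> b <= n -> #|I a b| = b - a.
Proof.
move=> ab bn; have e : I a b = [set x | rk x < b] :\: [set x | rk x < a].
  by apply/setP=> x; rewrite !inE -leqNgt.
rewrite e cardsD card_rk_lt (minn_idPl bn).
rewrite (setIidPr _) ?card_rk_lt ?(minn_idPl (leq_trans ab bn)) //.
by apply/subsetP=> x; rewrite !inE => xa; apply: leq_trans xa ab.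
Qed.

(** For [r <= rk x], the first rank of the block of length [t + 1] containing [x], blocks being
    counted from [r] on. *)
Let blk x := r + (rk x - r) %/ t.+1 * t.+1.

(** The ranks from [r] on split into full blocks; the ranks below [r] are covered by the clique on
    the first [t + 1] ranks, which meets only the first block, in the ranks from [r] to [t]. *)
Definition two_cliques : rel X := fun u v => (u != v) &&
  (((rk u < t.+1) && (rk v < t.+1)) || [&& r <= rk u, r <= rk v & blk u == blk v]).

Lemma rt : r <= t. Proof. by rewrite -ltnS ltn_mod. Qed.

Lemma two_cliques_graph : graph two_cliques.
Proof.
split=> [u v|u]; rewrite /two_cliques ?eqxx // eq_sym [blk u == _]eq_sym; congr (_ && _).
by congr (_ || _); [rewrite andbC | rewrite andbCA].
Qed.

Lemma blk_bounds x : r <= rk x -> x \in I (blk x) (blk x + t.+1).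
Proof.
move=> rx; rewrite inE /blk; have := divn_eq (rk x - r) t.+1; have := ltn_pmod (rk x - r) (ltn0Sn t).
by move: rx; clear; lia.
Qed.

Lemma blk_eq x y : r <= rk x -> y \in I (blk x) (blk x + t.+1) -> r <= rk y /\ blk y = blk x.
Proof.
move=> rx; rewrite inE => /andP[a b]; have ry : r <= rk y := leq_trans (leq_addr _ _) a.
split=> //; rewrite /blk; congr (_ + _ * _).
have e : rk y - r = (rk x - r) %/ t.+1 * t.+1 + (rk y - blk x) by move: a; rewrite /blk; move: (_ %/ _ * _) => q; clear; lia.
rewrite e divnMDl // [(rk y - _) %/ _]divn_small ?addn0 // ltn_subLR //.
Qed.

Lemma blk_le x : r <= rk x -> blk x + t.+1 <= n.
Proof.
move=> rx; have en := divn_eq n t.+1; rewrite -/r in en.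
have : (rk x - r) %/ t.+1 < n %/ t.+1.
  by rewrite ltn_divLR //; have := rk_lt x; move: en rx; clear; lia.
move=> lt; have : ((rk x - r) %/ t.+1).+1 * t.+1 <= n %/ t.+1 * t.+1 by rewrite leq_mul2r.
by rewrite /blk; move: en; clear; lia.
Qed.

Lemma two_cliques_wt v : t * t.-1 <= wt two_cliques v.
Proof.
have [rv|vr] := leqP r (rk v).
  have <- : #|I (blk v) (blk v + t.+1)|.-1 = t by rewrite card_I ?addKn ?leq_addr ?blk_le.
  apply: cliq_wt; last exact: blk_bounds.
  move=> x y xI yI xy; have [rx ex] := blk_eq rv xI; have [ry ey] := blk_eq rv yI.
  by rewrite /two_cliques xy rx ry ex ey eqxx orbT.
have <- : #|I 0 t.+1|.-1 = t by rewrite card_I ?subn0.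
apply: cliq_wt; last by rewrite inE /= (leq_trans vr) // ltnW // ltnS rt.
by move=> x y; rewrite !inE /= => xt yt xy; rewrite /two_cliques xy xt yt.
Qed.

(** Only vertices in the overlap can have degree above [t]; their additional neighbours are the [r]
    vertices of smallest rank. *)
Lemma two_cliques_deg v : #|nb two_cliques v| <= t + r * (v \in I r t.+1).
Proof.
have cb a : a + t.+1 <= n -> v \in I a (a + t.+1) -> #|I a (a + t.+1) :\ v| <= t.
  by move=> an va; have := cardsD1 v (I a (a + t.+1)); rewrite va card_I ?leq_addr //; clear; lia.
have [rv|vr] := leqP r (rk v); last first.
  apply: leq_trans (leq_addr _ _); apply: leq_trans (cb 0 _ _) => //; last first.
    by rewrite inE /= (leq_trans vr) // ltnW // ltnS rt.
  apply/subset_leq_card/subsetP=> u; rewrite !inE /two_cliques eq_sym => /andP[-> /=].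
  by rewrite [r <= rk v]leqNgt vr /= orbF => /andP[].
have bv := blk_bounds rv; have cv := cb _ (blk_le rv) bv.
have inb u : r <= rk u -> blk u = blk v -> u != v -> u \in I (blk v) (blk v + t.+1) :\ v.
  by move=> ru eu uv; rewrite in_setD1 uv -eu blk_bounds.
have [vt|tv] := ltnP (rk v) t.+1; last first.
  apply: leq_trans (leq_addr _ _); apply: leq_trans cv.
  apply/subset_leq_card/subsetP=> u; rewrite inE /two_cliques eq_sym ltnNge tv /=.
  by case/andP=> uv /and3P[_ ru /eqP e]; apply: inb.
rewrite [v \in I r _]inE rv vt muln1 addnC.
have c0 : #|I 0 r| <= r by rewrite card_I ?subn0 //; apply: leq_trans rt (ltnW tX).
apply: leq_trans (leq_add c0 cv).
apply: leq_trans (_ : #|I 0 r :|: (I (blk v) (blk v + t.+1) :\ v)| <= _); last exact: (leq_card_setU _ _).1.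
apply/subset_leq_card/subsetP=> u; rewrite in_setU [u \in nb _ _]inE /two_cliques eq_sym => /andP[uv].
have [ur|ru] := ltnP (rk u) r; first by rewrite inE ur.
move=> h; apply/orP; right; apply: inb => //.
case/orP: h => [/andP[_ ut]|/and3P[_ _ /eqP//]].
by rewrite /blk !divn_small //; move: ut vt; clear; lia.
Qed.

Lemma two_cliques_vol : 4 * vol two_cliques <= 4 * (t * n) + t.+1 * t.+1.
Proof.
have : vol two_cliques <= t * n + r * (t.+1 - r).
  have <- : #|I r t.+1| = t.+1 - r by rewrite card_I //; apply: leqW rt.
  have -> : t * n = \sum_(x : X) t by rewrite sum_nat_const mulnC.
  have -> : r * #|I r t.+1| = \sum_(x : X) r * (x \in I r t.+1).
    by rewrite -big_distrr /= -big_mkcond sum1_card.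
  by rewrite -big_split; apply: leq_sum => x _; apply: two_cliques_deg.
have := (nat_AGM2 r (t.+1 - r)).1; rewrite subnKC; last exact: leqW rt.
by rewrite -mulnn; move: (r * _) (vol _); clear; lia.
Qed.
End Construction.

(** * From triple systems to graphs *)

Section Fibres.
Variables (T U : finType) (f : T -> U) (A : {set T}) (B : {set U}) (k : nat).

Lemma card_fibre_le : {in A, forall x, f x \in B} ->
  {in B, forall y, #|[set x in A | f x == y]| <= k} -> #|A| <= k * #|B|.
Proof.
move=> fA fk; rewrite -sum1_card (partition_big f (fun y => y \in B)) //=.
rewrite mulnC -sum_nat_const; apply: leq_sum => y yB; apply: leq_trans (fk y yB).
by rewrite -sum1_card leq_eqVlt; apply/orP; left; apply/eqP/eq_bigl => x; rewrite inE.
Qed.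

Lemma card_fibre_ge :
  {in B, forall y, k <= #|[set x in A | f x == y]|} -> k * #|B| <= #|A|.
Proof.
move=> fk; rewrite -[#|A|]sum1_card (partition_big f xpredT) //= (bigID (fun y => y \in B)) /=.
apply: leq_trans (leq_addr _ _); rewrite mulnC -sum_nat_const; apply: leq_sum => y yB.
apply: leq_trans (fk y yB) _.
by rewrite -sum1_card leq_eqVlt; apply/orP; left; apply/eqP/eq_bigl => x; rewrite inE.
Qed.
End Fibres.

Lemma set2_eq (X : finType) (a b c d : X) : a != b -> [set c; d] = [set a; b] ->
  (c, d) = (a, b) \/ (c, d) = (b, a).
Proof.
move=> ab e; have ca : c \in [set a; b] by rewrite -e !inE eqxx.
have da : d \in [set a; b] by rewrite -e !inE eqxx orbT.
have ac : a \in [set c; d] by rewrite e !inE eqxx.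
have bc : b \in [set c; d] by rewrite e !inE eqxx orbT.
move: ca da ac bc; rewrite !inE => /orP[]/eqP-> /orP[]/eqP->; rewrite ?eqxx; auto.
  by rewrite orbb eq_sym (negPf ab).
by rewrite !orbb (negPf ab).
Qed.

Section Shadow.
Variable X : finType.
Implicit Types (F : {set {set X}}) (h : rel X).

Definition sgraph F : rel X := fun u v => (u != v) && ([set u; v] \in shadow2 F).
Definition triples h : {set {set X}} :=
  [set e : {set X} | (#|e| == 3) && [forall u in e, forall v in e, (u != v) ==> h u v]].

Lemma sgraph_graph F : graph (sgraph F).
Proof. by split=> [u v|u]; rewrite /sgraph ?eqxx // eq_sym setUC. Qed.

Lemma sgraph_mem F (e : {set X}) u v : e \in F -> u \in e -> v \in e -> u != v -> sgraph F u v.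
Proof.
move=> eF ue ve uv; rewrite /sgraph uv inE cards2 uv /=; apply/existsP; exists e.
by rewrite eF; apply/subsetP=> x; rewrite !inE => /orP[]/eqP->.
Qed.

Lemma triplesP h (e : {set X}) u v : e \in triples h -> u \in e -> v \in e -> u != v -> h u v.
Proof. by rewrite inE => /andP[_ /forall_inP H] ue ve uv; have /forall_inP/(_ v ve)/implyP := H u ue; apply. Qed.

Lemma sgraph_triples h : subrel (sgraph (triples h)) h.
Proof.
move=> u v /andP[uv]; rewrite inE => /andP[_ /existsP[e /andP[eT /subsetP s]]].
by apply: (triplesP eT) => //; apply: s; rewrite !inE eqxx ?orbT.
Qed.

Definition arcs h := [set p : X * X | h p.1 p.2].

Lemma vol_arcs h : vol h = #|arcs h|.
Proof.
rewrite /vol (eq_bigr (fun u => \sum_(v | h u v) 1)); last first.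
  by move=> u _; rewrite -sum1_card; apply: eq_bigl => v; rewrite inE.
rewrite pair_big_dep /= sum1_card; apply: eq_card => -[u w].
by rewrite !inE unfold_in.
Qed.

Lemma vol_sgraph F : vol (sgraph F) = 2 * #|shadow2 F|.
Proof.
rewrite vol_arcs; pose f (p : X * X) := [set p.1; p.2].
have fib a b : a != b -> [set a; b] \in shadow2 F ->
    [set p in arcs (sgraph F) | f p == [set a; b]] = [set (a, b); (b, a)].
  move=> ab abF; apply/setP=> -[c d]; rewrite !inE /f /=; apply/andP/orP => [[_ /eqP e]|].
    by have [->|->] := set2_eq ab e; [left | right].
  case=> /eqP[-> ->]; rewrite /sgraph; first by rewrite ab abF eqxx.
  by rewrite eq_sym ab [[set b; a]]setUC abF eqxx.
have cfib y : y \in shadow2 F -> #|[set p in arcs (sgraph F) | f p == y]| = 2.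
  move=> yF; have := yF; rewrite inE => /andP[/cards2P[a [b [ab ey]]] _].
  rewrite ey fib // -?ey // cards2; case: eqP => // -[ba _].
  by rewrite ba eqxx in ab.
apply/eqP; rewrite eqn_leq; apply/andP; split.
  apply: (card_fibre_le (f := f)) => [[c d]|y yF]; last by rewrite cfib.
  by rewrite inE /= => /andP[].
by apply: (card_fibre_ge (f := f)) => y yF; rewrite cfib.
Qed.

(** Edges of [h] in no triangle disappear from the shadow, whence only an inequality. *)
Lemma vol_triples h : 2 * #|shadow2 (triples h)| <= vol h.
Proof. by rewrite -vol_sgraph; apply: leq_sum => v _; apply/subset_leq_card/sub_nb/sgraph_triples. Qed.

(** A triple through [v] gives two ordered pairs. A triangle of the shadow graph need not be a
    member of [F], so equality can fail. *)
Lemma degree_sgraph F v : uniform3 F -> 2 * degree F v <= wt (sgraph F) v.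
Proof.
move=> u3; apply: (card_fibre_ge (f := fun p : X * X => v |: [set p.1; p.2])) => e.
rewrite inE => /andP[eF ve]; have e2 : #|e :\ v| == 2.
  by rewrite -eqSS -(u3 e eF) (cardsD1 v e) ve.
have /cards2P[a [b [ab eab]]] := e2.
have ee : e = v |: [set a; b] by rewrite -eab setD1K.
have [av ae] : a != v /\ a \in e.
  by have : a \in e :\ v; [rewrite eab !inE eqxx | rewrite !inE => /andP].
have [bv be] : b != v /\ b \in e.
  by have : b \in e :\ v; [rewrite eab !inE eqxx orbT | rewrite !inE => /andP].
have -> : 2 = #|[set (a, b); (b, a)]|.
  rewrite cards2; case: eqP => // -[ba _]; by rewrite ba eqxx in ab.
apply/subset_leq_card/subsetP => -[c d]; rewrite !inE => /orP[]/eqP[-> ->] /=.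
  by rewrite -ee eqxx !(sgraph_mem eF) // eq_sym.
by rewrite (setUC [set b]) -ee eqxx !(sgraph_mem eF) // eq_sym.
Qed.

Lemma wt_triples h v : graph h -> wt h v <= 2 * degree (triples h) v.
Proof.
move=> [hs hi]; apply: (card_fibre_le (f := fun p : X * X => v |: [set p.1; p.2])).
  move=> [a b]; rewrite !inE /= => /and3P[va vb ab]; rewrite eqxx /= andbT.
  have nva : v != a by apply: contraTneq va => ->; rewrite hi.
  have nvb : v != b by apply: contraTneq vb => ->; rewrite hi.
  have nab : a != b by apply: contraTneq ab => ->; rewrite hi.
  rewrite cardsU1 cards2 !inE negb_or nva nvb nab /=.
  apply/forall_inP=> x; rewrite !inE => /or3P[]/eqP->; apply/forall_inP=> y;
    rewrite !inE => /or3P[]/eqP->; apply/implyP; rewrite ?eqxx // => _ //; by rewrite hs.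
move=> e; rewrite inE => /andP[eT ve]; have e2 : #|e :\ v| == 2.
  by move: eT; rewrite inE => /andP[/eqP e3 _]; rewrite -eqSS -e3 (cardsD1 v e) ve.
have /cards2P[a [b [ab eab]]] := e2.
apply: leq_trans (_ : #|[set (a, b); (b, a)]| <= _); last by rewrite cards2; case: (_ != _).
apply/subset_leq_card/subsetP => -[c d]; rewrite inE => /andP[]; rewrite !inE /= => /and3P[vc vd cd] /eqP e'.
have e'' : [set c; d] = [set a; b].
  rewrite -eab -e'; apply/setP=> x; rewrite !inE; have [->|//] := eqVneq x v.
  by apply/negbTE; rewrite negb_or; apply/andP; split;
    [apply: contraTneq vc | apply: contraTneq vd] => <-; rewrite hi.
by have [->|->] := set2_eq ab e''; rewrite eqxx ?orbT.
Qed.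

Lemma leq_min_degree F c (x0 : X) :
  c <= min_degree F <-> forall u, c <= degree F u.
Proof.
have key s : (c <= \big[minn/#|F|]_(u <- s) degree F u) = (c <= #|F|) && all (fun u => c <= degree F u) s.
  elim: s => [|u s IH]; first by rewrite big_nil andbT.
  by rewrite big_cons leq_min IH /= andbCA.
rewrite /min_degree key; split=> [/andP[_ /allP H] u|H]; first by apply: H; rewrite mem_index_enum.
apply/andP; split; last by apply/allP=> u _; apply: H.
(* The default value [#|F|] of the minimum is harmless: it is at least the degree of [x0]. *)
apply: leq_trans (H x0) _; apply/subset_leq_card/subsetP => e; by rewrite inE => /andP[].
Qed.

(** All members of [F] through a vertex of [S] lie in [S]. Only ['C(t, 2)] triples in [S] contain
    that vertex, so the degree condition forces all of them into [F]. *)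
Lemma closed_isolated t F (S : {set X}) : (forall v, 'C(t, 2) <= degree F v) ->  uniform3 F ->
  #|S| = t.+1 -> {in S, forall v, nb (sgraph F) v = S :\ v} -> isolated_K3 t F S.
Proof.
move=> dF u3 eS nS.
have inS e v : e \in F -> v \in e -> v \in S -> e \subset S.
  move=> eF ve vS; apply/subsetP=> x xe; have [->//|xv] := eqVneq x v.
  have : x \in nb (sgraph F) v by rewrite inE (sgraph_mem eF) // eq_sym.
  by rewrite nS // !inE => /andP[].
split=> // [e eS3 e3|e eF [/set0Pn[u /setIP[ue uS]] /set0Pn[w /setIP[we]]]]; last first.
  by rewrite inE (subsetP (inS e u eF ue uS)).
have /card_gt0P[v ve] : 0 < #|e| by rewrite e3.
have vS := subsetP eS3 v ve.
pose D := [set e' in F | v \in e'].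
pose G := [set e' : {set X} | [&& e' \subset S, v \in e' & #|e'| == 3]].
have DG : D \subset G.
  apply/subsetP=> e'; rewrite !inE => /andP[eF' ve'].
  by rewrite (inS e' v) // ve' (u3 e') // eqxx.
have GC : #|G| <= 'C(t, 2).
  have <- : #|S :\ v| = t by apply/eqP; rewrite -eqSS -eS (cardsD1 v S) vS.
  rewrite -cards_draws -(card_in_imset (f := fun e' : {set X} => e' :\ v)).
    apply/subset_leq_card/subsetP => x /imsetP[e']; rewrite !inE => /and3P[s' ve' /eqP e3'] ->.
    by rewrite setSD //= -eqSS -e3' (cardsD1 v e') ve'.
  move=> e1 e2; rewrite !inE => /and3P[_ v1 _] /and3P[_ v2 _] /= E.
  by rewrite -(setD1K v1) E setD1K.
have /eqP DE : D == G by rewrite eqEcard DG; apply: leq_trans GC (dF v).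
by have : e \in D; [rewrite DE !inE eS3 ve e3 | rewrite inE => /andP[]].
Qed.

Lemma bin2_double t : 2 * 'C(t, 2) = t * t.-1.
Proof. by rewrite mulnC -[2]/(2`!) bin_ffact ffactnS ffactn1. Qed.

(* [63 / 10] is just below [1 + sqrt (928 / 33)]. *)
Theorem isolated_clique t F : 100 <= t -> 63 * (t * t) <= 10 * #|X| ->
  extremal t F -> exists S : {set X}, isolated_K3 t F S.
Proof.
move=> t100 tX [u3 dF minF].
have h1 : 100 * t <= t * t by rewrite leq_mul2r t100 orbT.
have tX' : t < #|X| by move: t100 tX h1; clear; lia.
have /card_gt0P[x0 _] : 0 < #|X| by apply: leq_ltn_trans tX'.
have dF' := (leq_min_degree F 'C(t, 2) x0).1 dF.
pose g := sgraph F; have gg : graph g := sgraph_graph F.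
have [/existsP[S /andP[/eqP eS /forall_inP nS]]|no] :=
  boolP [exists S : {set X}, (#|S| == t.+1) && [forall v in S, nb g v == S :\ v]].
  by exists S; apply: closed_isolated => // v vS; apply/eqP/nS.
exfalso.
have gW v : t * t.-1 <= wt g v.
  by rewrite -bin2_double; apply: leq_trans (degree_sgraph v u3); rewrite leq_mul2l dF'.
have gmin h : graph h -> (forall v, t * t.-1 <= wt h v) -> vol g <= vol h.
  move=> gh hW; apply: leq_trans (vol_triples h); rewrite vol_sgraph leq_mul2l /=.
  apply: minF => [e|]; first by rewrite inE => /andP[/eqP].
  apply/(leq_min_degree _ _ x0) => v; rewrite -(leq_pmul2l (isT : 0 < 2)) bin2_double.
  by apply: leq_trans (hW v) _; apply: wt_triples.
have niso (S : {set X}) : #|S| = t.+1 -> {in S, forall v, nb g v = S :\ v} -> False.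
  move=> eS nS; apply: (negP no); apply/existsP; exists S; rewrite eS eqxx /=.
  by apply/forall_inP => v vS; apply/eqP/nS.
have t1 : 1 < t by apply: leq_trans t100.
have v1 : vol g = t * #|X| + \sum_v exc t g v.
  rewrite /vol (eq_bigr (fun v => t + exc t g v)) => [|v _]; last by apply: degE.
  by rewrite big_split sum_nat_const /= mulnC.
have v2 := gmin _ (two_cliques_graph X t) (two_cliques_wt tX').
have v3 := two_cliques_vol tX'.
have t24 : 23 < t by apply: leq_trans t100.
have := card_le_excess t1 gg gW gmin niso t24.
(* Since [vol g] is [t * #|X|] plus the total excess, comparison with [two_cliques] bounds the
   latter. *)
have e4 : 4 * \sum_v exc t g v <= t.+1 * t.+1 by move: v1 v2 v3; clear; lia.
have h2 : 100 * (t * t) <= t * (t * t) by rewrite leq_mul2r t100 orbT.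
have h3 : (24 * t + 6) * (4 * \sum_v exc t g v) <= (24 * t + 6) * (t.+1 * t.+1).
  by rewrite leq_mul2l e4 orbT.
have h4 : t * (63 * (t * t)) <= t * (10 * #|X|) by rewrite leq_mul2l tX orbT.
(* The upper bound for [4 * t * #|X|] has leading term [24 * t ^ 3], the lower bound is
   [25.2 * t ^ 3]; [t >= 100] absorbs the lower-order terms. *)
move: (\sum_v _) #|X| h1 h2 h3 h4 t100 => S n; clear; lia.
Qed.

End Shadow.

(* Passage to the real constant *)
From mathcomp Require Import all_classical all_reals all_analysis.
From mathcomp Require Import lra.

Import Order.TTheory GRing.Theory Num.Theory.
Import numFieldNormedType.Exports.

Local Open Scope classical_set_scope.
Local Open Scope ring_scope.

(* The argument leaves room below the constant, so [h = 0] works. *)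
Theorem theorem7 (R : realType) :
  exists (h : nat -> R) (t0 : nat),
    h =o_\oo (fun t : nat => t%:R ^+ 2 : R) /\
    forall t : nat, (2 <= t)%N -> (t0 <= t)%N ->
    forall (X : finType),
      (1 + Num.sqrt (928 / 33)) * t%:R ^+ 2 + h t <= #|X|%:R ->
    forall F : {set {set X}}, extremal t F ->
      exists S : {set X}, isolated_K3 t F S.
Proof.
exists (fun=> 0), 100%N; split.
  by apply/eqoP => e e0; near=> n; rewrite normr0 mulr_ge0 // ltW.
move=> t _ t100 X; rewrite addr0 => tX F; apply: isolated_clique => //.
(* The square of [53 / 10] is [28.09], while [928 / 33] exceeds [28.12]. *)
have s53 : 53 / 10 <= Num.sqrt (928 / 33) :> R.
  have -> : 53 / 10 = Num.sqrt ((53 / 10) ^+ 2) :> R by rewrite sqrtr_sqr ger0_norm //; lra.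
  by rewrite ler_sqrt; lra.
rewrite -(ler_nat R) !natrM; have := tX; rewrite expr2.
have : 0 <= t%:R * t%:R :> R by rewrite mulr_ge0.
by nra.
Unshelve. all: by end_near.
Qed.
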